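(* Let $(W,S)$ and $(W',S')$ be Coxeter systems with two-dimensional Davis-Vinberg complexes, i.e. $\dim\Sigma(W,S)=\dim\Sigma(W',S')=2$. Suppose that there exists a group isomorphism $\phi:W\rightarrow W'$. For each $s\in S$, if $\phi(s)$ is not a reflection in $(W',S')$, then there exist unique elements $t\in S$ and $s',t'\in S'$ such that for some $w'\in W'$ all of the following hold: (1) $m(s,t)=2$; (2) $m(s,u)=\infty$ for each $u\in S\setminus\{s,t\}$; (3) $\phi(W_{\{s,t\}})=w'W'_{\{s',t'\}}(w')^{-1}$; (4) $m'(s',t')=2$; (5) $m'(s',u')=\infty$ for each $u'\in S'\setminus\{s',t'\}$; (6) $\phi(s)=w's't'(w')^{-1}$; and (7) $\phi(t)=w't'(w')^{-1}$.
   Context: A Coxeter system $(W,S)$ consists of a group $W$ and a finite generating set $S\subset W$ such that $W$ has the presentation $\langle S \mid (st)^{m(s,t)}=1 \text{ for } s,t\in S\rangle$, where $m:S\times S\to\mathbb{N}\cup\{\infty\}$ satisfies $m(s,t)=m(t,s)$, $m(s,s)=1$, and $m(s,t)\ge 2$ for $s\ne t$ (there is no relation when $m(s,t)=\infty$). Then $m(s,t)$ is the order of $st$ in $W$; $m'(s',t')$ denotes the order of $s't'$ in $W'$ for a system $(W',S')$. For $T\subset S$, $W_T$ denotes the subgroup of $W$ generated by $T$ (parabolic subgroup; trivial if $T=\emptyset$), and likewise $W'_{T'}$ for $T'\subset S'$. A reflection in $(W,S)$ is a conjugate in $W$ of an element of $S$. A subset $T\subset S$ is spherical if $W_T$ is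 finite. The Davis-Vinberg complex $\Sigma(W,S)$ is the geometric realization of the set of all left cosets $wW_T$ ($w\in W$, $T\subset S$ spherical) partially ordered by inclusion; its dimension is $\dim\Sigma(W,S)=\max\{|T| : T \text{ is a spherical subset of } S\}$. *)

(* Defs.v *)
From mathcomp Require Import all_boot finmap.
From mathcomp Require Export monoid.
From mathcomp Require Import boolp classical_sets functions cardinality.

Set Implicit Arguments.
Unset Strict Implicit.
Unset Printing Implicit Defensive.

Local Open Scope fset_scope.
Local Open Scope classical_set_scope.
Local Open Scope group_scope.

(* Words in the free monoid on X and formal inverses of X; the letter (x, true)
   stands for x^-1. *)
Definition word (X : Type) := seq (X * bool).

(* Equality, in the quotient of the free group on X by the normal closure of
   the relators R, of the elements represented by two words. *)
Inductive word_eq (X : Type) (R : set (word X)) : word X -> word X -> Prop :=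
| word_eq_refl u : word_eq R u u
| word_eq_sym u v : word_eq R u v -> word_eq R v u
| word_eq_trans u v w : word_eq R u v -> word_eq R v w -> word_eq R u w
| word_eq_cancel u v x b :
    word_eq R (u ++ [:: (x, b); (x, ~~ b)] ++ v) (u ++ v)
| word_eq_relator u v r : R r -> word_eq R (u ++ r ++ v) (u ++ v).

Definition word_eval (X : Type) (G : groupType) (f : X -> G) (w : word X) : G :=
  \prod_(a <- w) (if a.2 then (f a.1)^-1 else f a.1).

(* The map X -> G induces an isomorphism < X | R > -> G: it is onto, and a word
   evaluates to 1 only as a consequence of the relators. *)
Definition has_presentation (X : Type) (R : set (word X))
    (G : groupType) (f : X -> G) : Prop :=
  (forall g : G, exists w : word X, word_eval f w = g) /\
  (forall w : word X, word_eval f w = 1 <-> word_eq R w [::]).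

(* Here and below m s t = None encodes m(s,t) = infinity; only the values of m
   on S are relevant. *)
Definition coxeter_relators (W : groupType) (S : {fset W})
    (m : W -> W -> option nat) : set (word S) :=
  [set r | exists (s t : S) (n : nat),
     m (val s) (val t) = Some n /\
     r = flatten (nseq n [:: (s, false); (t, false)])].

Record coxeter_system (W : groupType) (S : {fset W})
    (m : W -> W -> option nat) : Prop := CoxeterSystem {
  coxeter_m_sym : {in S &, forall s t, m s t = m t s};
  coxeter_m_diag : {in S, forall s, m s s = Some 1%N};
  coxeter_m_ge2 : {in S &, forall s t, s != t ->
    forall n, m s t = Some n -> (2 <= n)%N};
  coxeter_presentation :
    has_presentation (coxeter_relators (S := S) m) (fun s : S => val s)
}.

Definition parabolic (W : groupType) (T : {fset W}) : set W :=
  smallest [set H : set W | group_closed (mem H)] [set` T].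

Definition spherical (W : groupType) (T : {fset W}) : Prop :=
  finite_set (parabolic T).

Definition reflection (W : groupType) (S : {fset W}) (r : W) : Prop :=
  exists (w s : W), s \in S /\ r = w * s * w^-1.

Definition spherical_coset (W : groupType) (S : {fset W}) (A : set W) : Prop :=
  exists (w : W) (T : {fset W}),
    [/\ (T `<=` S)%fset, spherical T & A = [set w * x | x in parabolic T]].

(* The Davis-Vinberg complex is the geometric realization of the poset of
   spherical cosets: its simplices are the nonempty finite chains. *)
Definition davis_simplex (W : groupType) (S : {fset W})
    (c : {fset set W}) : Prop :=
  [/\ c != fset0,
      forall A, A \in c -> spherical_coset S A &
      forall A B, A \in c -> B \in c -> (A `<=` B)%classic \/ (B `<=` A)%classic].

(* A simplex with n.+1 vertices has dimension n.  For a Coxeter system, this n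
   is the largest cardinality of a spherical subset of S. *)
Definition davis_dim (W : groupType) (S : {fset W}) (n : nat) : Prop :=
  (exists c : {fset set W}, davis_simplex S c /\ #|` c| = n.+1) /\
  (forall c : {fset set W}, davis_simplex S c -> (#|` c| <= n.+1)%N).

(* Main.v *)
(* Let z = phi s.  Being an involution but not a reflection, z is conjugate into
   a finite dihedral parabolic W'_{a,b}, where it is central and acts as -1 on
   the plane spanned by the two simple roots in the geometric representation.
   As no spherical subset has three elements, the centralizer of z is exactly
   this conjugate of W'_{a,b}, hence finite.  So the centralizer of s is finite,
   lies in a conjugate of a finite dihedral parabolic W_{e,f} with s conjugate
   to e, and consists of involutions; thus W'_{a,b} is a Klein four-group and
   z is conjugate to a b.  If m(s,u) is finite, then phi s and phi u generate a
   finite group, lying in a dihedral parabolic in which phi s is central, so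
   m(s,u) = 2.  Therefore the sign of s alone is a character of W, which forces
   e = s and C(s) = W_{s,f}.  The condition on m' follows by applying
   this to the inverse isomorphism, which maps a generator of S' to the
   non-reflection s f, and uniqueness by evaluating the character of s'. *)
Require Import Defs.
From Stdlib Require Import Reals.
From mathcomp Require Import all_boot all_order all_algebra finmap.
From mathcomp Require Import boolp classical_sets functions cardinality.
From mathcomp Require Import Rstruct ring lra zify.

Set Implicit Arguments.
Unset Strict Implicit.
Unset Printing Implicit Defensive.

Import Order.TTheory GRing.Theory Num.Theory.

(** * Chebyshev polynomials at 2 cos (PI / n) *)

Section Cosines.
Local Open Scope ring_scope.

(** Rescaled Chebyshev polynomials of the second kind: at c = 2 cos x the value is sin (n x) / sin
    x. The index is shifted by one from the usual U_n, so that index 0 gives 0. *)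
Fixpoint cheb (R : pzRingType) (c : R) (n : nat) : R :=
  if n is n1.+1 then
    if n1 is n2.+1 then c * cheb c n1 - cheb c n2 else 1
  else 0.
#[global] Arguments cheb : simpl never.

Lemma cheb0 (R : pzRingType) (c : R) : cheb c 0 = 0.
Proof. by []. Qed.

Lemma cheb1 (R : pzRingType) (c : R) : cheb c 1 = 1.
Proof. by []. Qed.

Lemma chebSS (R : pzRingType) (c : R) n : cheb c n.+2 = c * cheb c n.+1 - cheb c n.
Proof. by []. Qed.

(** The limit case of angle 0, which serves m(s,t) = infinity. *)
Lemma cheb2 (R : comPzRingType) n : cheb (2 : R) n = n%:R.
Proof.
suff [] : cheb (2 : R) n = n%:R /\ cheb (2 : R) n.+1 = n.+1%:R by [].
elim: n => [//|n [IH1 IH2]]; split=> //.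
by rewrite chebSS IH1 IH2 -[n.+2%:R]natr1 -[n.+1%:R]natr1; ring.
Qed.

Lemma cheb_sin (x : Rdefinitions.R) (n : nat) :
  cheb (2 * cos x) n * sin x = sin (n%:R * x)%R.
Proof.
suff [] : cheb (2 * cos x) n * sin x = sin (n%:R * x)%R /\
  cheb (2 * cos x) n.+1 * sin x = sin (n.+1%:R * x)%R by [].
elim: n => [|n [IH1 IH2]].
  by rewrite !mul0r !mul1r; split=> //; apply/esym/sin_0.
split=> //.
rewrite chebSS mulrBl IH1 -mulrA IH2.
have eD : n.+2%:R * x = n.+1%:R * x + x by rewrite -[n.+2%:R]natr1 mulrDl mul1r.
have eB : n%:R * x = n.+1%:R * x - x by rewrite -[n.+1%:R]natr1 mulrDl mul1r addrK.
have sinD (y z : Rdefinitions.R) :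
  sin (y + z)%R = sin y * cos z + cos y * sin z := sin_plus y z.
have sinB (y z : Rdefinitions.R) :
  sin (y - z)%R = sin y * cos z - cos y * sin z := sin_minus y z.
by rewrite eD eB sinB sinD; ring.
Qed.

(* c o stands for 2 cos (PI / o), where PI / infinity = 0. *)
Definition cosine_family (R : realFieldType) (c : option nat -> R) :=
  [/\ c None = 2, c (Some 1%N) = - 2 &
      forall n : nat, (2 <= n)%N ->
        [/\ c (Some n) ^+ 2 != 4, c (Some n) = 0 -> n = 2%N,
            forall k, (k <= n)%N -> 0 <= cheb (c (Some n)) k,
            cheb (c (Some n)) (n + n) = 0 & cheb (c (Some n)) (n + n).+1 = 1]].

(** Trigonometry is confined to this construction: the geometric representation uses only the
    properties of a cosine family, over any ordered field. *)
Lemma exists_cosine_family :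
  exists (R : realFieldType) (c : option nat -> R), cosine_family c.
Proof.
exists Rdefinitions.R.
exists (fun o => if o is Some n then 2 * cos (PI / n%:R)%R else 2); split=> //.
  by rewrite divr1 (cos_PI : cos PI = -1) mulrN mulr1.
move=> n n2; have n0 : (0 < n%:R :> Rdefinitions.R) by rewrite ltr0n ltnW.
have PI0 : 0 < PI by apply/RltP/PI_RGT_0.
set x := PI / n%:R.
have nx : n%:R * x = PI by rewrite mulrC divfK // gt_eqF.
have x0 : 0 < x by rewrite divr_gt0.
have x1 : x <= PI / 2.
  by rewrite ler_pM2l // lef_pV2 ?posrE // ler_nat.
have sx : 0 < sin x.
  by apply/RltP/sin_gt_0; apply/RltP => //; apply: (le_lt_trans x1); lra.
have chebE k : cheb (2 * cos x) k = sin (k%:R * x)%R / sin x.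
  by rewrite -cheb_sin mulfK // gt_eqF.
split.
- have h : sin x ^+ 2 + cos x ^+ 2 = 1 := sin2_cos2 x.
  apply/eqP => e.
  have : sin x ^+ 2 > 0 by rewrite exprn_gt0.
  nra.
- move=> /eqP; rewrite mulf_eq0 pnatr_eq0 /= => /eqP cx0.
  apply/eqP; rewrite eqn_leq n2 andbT leqNgt; apply/negP => n3.
  have : (0 < cos x)%R; last by rewrite cx0 ltxx.
  have x2 : x < PI / 2.
    by rewrite ltr_pM2l // ltf_pV2 ?posrE // ltr_nat.
  have x3 : - (PI / 2) < x by apply: lt_trans x0; rewrite oppr_lt0 divr_gt0.
  by apply/RltP/cos_gt_0; apply/RltP.
- move=> k kn; rewrite chebE divr_ge0 //; last exact: ltW.
  apply/RleP/sin_ge_0; apply/RleP.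
    by rewrite mulr_ge0 ?ler0n // ltW.
  by rewrite -nx ler_wpM2r ?ler_nat // ltW.
- have sinDPI (y : Rdefinitions.R) : sin (y + PI)%R = - sin y := neg_sin y.
  by rewrite chebE natrD mulrDl nx sinDPI (sin_PI : sin PI = 0) oppr0 mul0r.
- have sinDPI (y : Rdefinitions.R) : sin (y + PI)%R = - sin y := neg_sin y.
  rewrite chebE -natr1 natrD !mulrDl nx mul1r addrC addrA !sinDPI opprK.
  by rewrite divff // gt_eqF.
Qed.

End Cosines.

(** * Words and lengths *)

Section Words.
Local Open Scope group_scope.
Variables (W : groupType) (S : {fset W}) (m : W -> W -> option nat).
Hypothesis cox : coxeter_system S m.
Implicit Types (s t : S) (g h : W) (w : seq S).

Lemma word_eval_cat (u v : word S) (f : S -> W) :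
  word_eval f (u ++ v) = word_eval f u * word_eval f v.
Proof. exact: big_cat. Qed.

Lemma coxeter_relation s t n :
  m (val s) (val t) = Some n -> (val s * val t) ^+ n = 1.
Proof.
move=> mst; have [_ pres] := coxeter_presentation cox.
set r : word S := flatten (nseq n [:: (s, false); (t, false)]).
have <- : word_eval (fun s : S => val s) r = (val s * val t) ^+ n.
  rewrite /r; elim: n {mst r} => [|n IH]; first by rewrite /word_eval big_nil.
  by rewrite expgS -IH /= /word_eval !big_cons /= mulgA.
apply/pres; rewrite -[r]cat0s -[r in _ ++ r]cats0.
by apply: (word_eq_relator [::] [::]); exists s, t, n.
Qed.

Lemma genK s : val s * val s = 1.
Proof. exact: (@coxeter_relation s s 1 (coxeter_m_diag cox (valP s))). Qed.

Lemma genV s : (val s)^-1 = val s.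
Proof. by apply: mulg1_eq; exact: genK. Qed.

Definition ev w : W := \prod_(s <- w) val s.

Lemma ev_cons s w : ev (s :: w) = val s * ev w.
Proof. exact: big_cons. Qed.

Lemma ev_cat w1 w2 : ev (w1 ++ w2) = ev w1 * ev w2.
Proof. exact: big_cat. Qed.

Lemma ev_rcons w s : ev (rcons w s) = ev w * val s.
Proof. by rewrite -cats1 ev_cat ev_cons /ev big_nil mulg1. Qed.

Lemma ev_surj g : exists w, ev w = g.
Proof.
have [/(_ g) [w <-] _] := coxeter_presentation cox.
exists [seq a.1 | a <- w]; rewrite /ev /word_eval big_map.
by apply: eq_bigr => -[s b] _ /=; case: b; rewrite ?genV.
Qed.

Lemma gen_ind (P : W -> Prop) :
  P 1 -> (forall g s, P g -> P (g * val s)) -> forall g, P g.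
Proof.
move=> P1 PM g; have [w <-] := ev_surj g.
elim/last_ind: w => [|w s IH]; first by rewrite /ev big_nil.
by rewrite ev_rcons; exact: PM.
Qed.

(** The universal property of the presentation, phrased for actions on a set: the letter-by-letter
    action of words descends to W. *)
Lemma coxeter_action (X : Type) (sigma : S -> X -> X) :
  (forall s t n, m (val s) (val t) = Some n ->
     forall x, iter n (sigma s \o sigma t) x = x) ->
  exists act : W -> X -> X,
    [/\ forall x, act 1 x = x, forall g h x, act (g * h) x = act g (act h x) &
        forall s x, act (val s) x = sigma s x].
Proof.
move=> rel; have [surj pres] := coxeter_presentation cox.
have sigmaK s x : sigma s (sigma s x) = x.
  by have := rel s s _ (coxeter_m_diag cox (valP s)) x.
pose run (w : word S) x := foldr (fun a => sigma a.1) x w.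
have run_cat u v x : run (u ++ v) x = run u (run v x) by rewrite /run foldr_cat.
have run_eq u v : word_eq (coxeter_relators m) u v -> forall x, run u x = run v x.
  elim=> {u v} [u|u v _ IH|u v w _ IH1 _ IH2|u v s b|u v r [s [t [n [mst ->]]]]] x //.
  - by rewrite IH1.
  - by rewrite !run_cat /= sigmaK.
  rewrite !run_cat; congr run.
  rewrite -[RHS](rel _ _ _ mst); elim: n {mst} => [//|n IH].
  by rewrite iterS /= -IH.
pose inv (w : word S) : word S := rev [seq (a.1, ~~ a.2) | a <- w].
have run_inv (w : word S) x : run (inv w) (run w x) = x.
  rewrite /inv; elim: w x => [//|[s b] w IH] x /=.
  by rewrite rev_cons -cats1 run_cat /= sigmaK.
have eval_inv (w : word S) : word_eval (fun s : S => val s) (inv w) =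
    (word_eval (fun s : S => val s) w)^-1.
  rewrite /inv; elim: w => [|[s b] w IH]; first by rewrite /word_eval !big_nil invg1.
  rewrite /= rev_cons -cats1 word_eval_cat IH /word_eval !big_cons big_nil mulg1.
  by rewrite invgM; case: b => /=; rewrite ?invgK.
have run_eval u v : word_eval (fun s : S => val s) u = word_eval (fun s : S => val s) v ->
    forall x, run u x = run v x.
  (* The presentation decides only which words have value 1, so [inv v] is inserted after [u] and
     [u ++ inv v] is reduced to the empty word. *)
  move=> uv x; rewrite -[in LHS](run_inv v x) -run_cat (run_eq _ [::]) //.
  by apply/pres; rewrite word_eval_cat eval_inv uv mulgV.
pose wd g := projT1 (cid (surj g)).
have wdE g : word_eval (fun s : S => val s) (wd g) = g := projT2 (cid (surj g)).
exists (fun g x => run (wd g) x); split.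
- by move=> x; rewrite (run_eval _ [::]) // wdE /word_eval big_nil.
- by move=> g h x; rewrite -run_cat; apply: run_eval; rewrite word_eval_cat !wdE.
- move=> s x; rewrite (run_eval _ [:: (s, false)]) // wdE.
  by rewrite /word_eval big_cons big_nil mulg1.
Qed.

(** W acts on the two-element set [bool] by translations, a relator of exponent n translating by n
    (p s + p t); the character is the image of [false]. *)
Lemma coxeter_character (p : S -> bool) :
  (forall s t n, m (val s) (val t) = Some n -> p s != p t -> ~~ odd n) ->
  exists chi : W -> bool,
    {morph chi : g h / g * h >-> g (+) h} /\ forall s, chi (val s) = p s.
Proof.
move=> hp; have [|act [act1 actM act_gen]] :=
  @coxeter_action bool (fun s => addb (p s)).
  move=> s t n /hp pn x; have -> : iter n (addb (p s) \o addb (p t)) x =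
    odd n && (p s != p t) (+) x.
    elim: n {pn} => [//|n /= ->].
    by case: (p s) (p t) (odd n) x => [] [] [] [].
  by case: eqP pn => [|_ /(_ isT) /negbTE ->]; rewrite ?andbF.
have act_addb g x : act g x = act g false (+) x.
  elim/gen_ind: g x => [|g s IH] x; first by rewrite !act1.
  by rewrite !actM !act_gen IH [in RHS]IH addbF addbA.
exists (act^~ false); split=> [g h|s]; first by rewrite actM act_addb.
by rewrite act_gen addbF.
Qed.

Lemma exists_sign : exists chi : W -> bool,
  {morph chi : g h / g * h >-> g (+) h} /\ forall s, chi (val s) = true.
Proof. by apply: coxeter_character. Qed.

Lemma exists_length g : exists n, `[< exists w, size w = n /\ ev w = g >].
Proof. by have [w wg] := ev_surj g; exists (size w); apply/asboolP; exists w. Qed.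

Definition len g := ex_minn (exists_length g).

Lemma len_word g : exists2 w, size w = len g & ev w = g.
Proof. by rewrite /len; case: ex_minnP => n /asboolP [w [<- <-]] _; exists w. Qed.

Lemma len_ev w : (len (ev w) <= size w)%N.
Proof.
by rewrite /len; case: ex_minnP => n _; apply; apply/asboolP; exists w.
Qed.

Lemma len_mulr g w : (len (g * ev w) <= len g + size w)%N.
Proof.
have [v <- <-] := len_word g.
by rewrite -ev_cat -size_cat len_ev.
Qed.

Lemma len_gen g s : (len (g * val s) <= (len g).+1)%N.
Proof.
have := len_mulr g [:: s]; rewrite ev_cons /ev big_nil mulg1 addn1.
exact.
Qed.

Lemma mulgenK g s : g * val s * val s = g.
Proof. by rewrite -mulgA genK mulg1. Qed.

(** The sign character computes the parity of the length, and a generator changes the sign. *)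
Lemma len_gen_neq g s : len (g * val s) != len g.
Proof.
have [chi [chiM chi_gen]] := exists_sign.
have chi_len h : chi h = odd (len h).
  have [w <- <-] := len_word h; elim: w => [|t w IH].
    by rewrite /ev big_nil; have := chiM 1 1; rewrite mulg1; case: (chi 1).
  by rewrite ev_cons chiM chi_gen IH.
apply/eqP => e; have := chi_len (g * val s).
by rewrite e -chi_len chiM chi_gen addbT; case: (chi g).
Qed.

Lemma len_gen_cases g s :
  len (g * val s) = (len g).+1 \/ (len (g * val s)).+1 = len g.
Proof.
have := len_gen g s; have := len_gen (g * val s) s; rewrite mulgenK.
have := len_gen_neq g s; lia.
Qed.

Lemma len_descent g : g != 1 -> exists s, (len (g * val s)).+1 = len g.
Proof.
move=> g1; have [w szw wg] := len_word g.
case/lastP: w => [|w s] in szw wg; first by rewrite -wg /ev big_nil eqxx in g1.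
exists s; have [e|//] := len_gen_cases g s.
have := len_ev w; move: szw; rewrite size_rcons -(mulgenK (ev w) s) -ev_rcons wg.
lia.
Qed.

End Words.

Lemma finite_set_inj (T U : Type) (A : set T) (f : T -> U) :
  {in A &, injective f} -> finite_set (f @` A) -> finite_set A.
Proof. by move=> /inj_card_eq /eq_finite_set ->. Qed.

(** * Subgroups generated by finite sets *)

Section Parabolic.
Local Open Scope group_scope.
Variable W : groupType.
Implicit Types (H : set W) (T : {fset W}) (x y : W).

Lemma group_setP H : group_closed (mem H) <->
  [/\ H 1, forall x y, H x -> H y -> H (x * y) & forall x, H x -> H x^-1].
Proof.
split=> [gH|[H1 HM HV]].
  have [/set_mem H1 _] := gH; split=> // [x y /mem_set Hx /mem_set Hy|x /mem_set Hx].
    exact/set_mem/(group_closedM gH).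
  exact/set_mem/(group_closedV gH).
split=> [|x y /set_mem Hx /set_mem Hy]; apply/mem_set => //.
by apply: HM => //; apply: HV.
Qed.

Lemma parabolic_sub H T :
  group_closed (mem H) -> (forall t, t \in T -> H t) ->
  forall x, parabolic T x -> H x.
Proof. by move=> gH TH; exact: smallest_sub. Qed.

Lemma parabolic_gen T t : t \in T -> parabolic T t.
Proof. by move=> tT; apply: sub_gen_smallest. Qed.

Lemma parabolic_closed T : group_closed (mem (parabolic T)).
Proof.
apply/group_setP; split=> [|x y xT yT|x xT] H HT;
  have [/group_setP [H1 HM HV] _] := HT => //.
  exact: HM (xT H HT) (yT H HT).
exact: HV (xT H HT).
Qed.

Lemma parabolic1 T : parabolic T 1.
Proof. by have /group_setP [] := parabolic_closed T. Qed.

Lemma parabolicM T x y : parabolic T x -> parabolic T y -> parabolic T (x * y).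
Proof. by have /group_setP [_ + _] := parabolic_closed T; exact. Qed.

Lemma parabolicV T x : parabolic T x -> parabolic T x^-1.
Proof. by have /group_setP [_ _] := parabolic_closed T; exact. Qed.

Lemma parabolic_fset2l (a b : W) : parabolic [fset a; b]%fset a.
Proof. by apply: parabolic_gen; rewrite !inE eqxx. Qed.

Lemma parabolic_fset2r (a b : W) : parabolic [fset a; b]%fset b.
Proof. by apply: parabolic_gen; rewrite !inE eqxx orbT. Qed.

End Parabolic.

(** * The geometric representation *)

Section GeometricRepresentation.
Local Open Scope ring_scope.
Variables (W : groupType) (S : {fset W}) (m : W -> W -> option nat).
Hypothesis cox : coxeter_system S m.
Variables (R : realFieldType) (c : option nat -> R).
Hypothesis cosc : cosine_family c.
Local Notation V := {ffun S -> R^o}.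
Local Notation len := (len cox).
Implicit Types (s t x y : S) (g h : W) (u v : V) (a b : R).

(** The simple roots, as the standard basis of [V]. *)
Definition alpha s : V := [ffun t => (t == s)%:R].

(** Equals -2 B(alpha s, alpha t); with this sign it is the argument 2 cos (PI / m(s,t)) of the
    Chebyshev polynomials. *)
Definition coef s t : R := c (m (val s) (val t)).

(* cform v s = 2 B(v, alpha s), where B(alpha s, alpha t) = - cos (PI / m(s,t)). *)
Definition cform v s : R := - \sum_t v t * coef t s.

Definition refl s v : V := v - cform v s *: alpha s.

Lemma coef_sym s t : coef s t = coef t s.
Proof. by rewrite /coef (coxeter_m_sym cox (valP s) (valP t)). Qed.

Lemma coef_diag s : coef s s = - 2.
Proof. by rewrite /coef (coxeter_m_diag cox (valP s)); case: cosc. Qed.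

Lemma cformP a u v s : cform (a *: u + v) s = a * cform u s + cform v s.
Proof.
rewrite /cform mulrN -opprD; congr (- _); rewrite mulr_sumr -big_split /=.
by apply: eq_bigr => t _; rewrite !ffunE mulrDl mulrA.
Qed.

Lemma cform_alpha t s : cform (alpha t) s = - coef t s.
Proof.
rewrite /cform (bigD1 t) //= big1 ?addr0 => [|u /negbTE ut]; rewrite ffunE.
  by rewrite eqxx mul1r.
by rewrite ut mul0r.
Qed.

Lemma reflP s a u v : refl s (a *: u + v) = a *: refl s u + refl s v.
Proof.
by rewrite /refl cformP; apply/ffunP => t; rewrite !ffunE /GRing.scale /=; ring.
Qed.

Lemma refl_alpha2 x y a b :
  refl y (a *: alpha x + b *: alpha y) =
  a *: alpha x + (coef x y * a - b) *: alpha y.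
Proof.
rewrite /refl -[b *: alpha y]addr0 !cformP !cform_alpha coef_diag.
have -> : cform 0 y = 0.
  by rewrite /cform big1 ?oppr0 // => t _; rewrite ffunE mul0r.
by apply/ffunP => t; rewrite !ffunE /GRing.scale /=; ring.
Qed.

Lemma refl_alpha s : refl s (alpha s) = - alpha s.
Proof.
have := refl_alpha2 s s 0 1; rewrite !scale0r !add0r mulr0 sub0r scale1r => ->.
by rewrite scaleN1r.
Qed.

Lemma reflK s v : refl s (refl s v) = v.
Proof.
rewrite {2}/refl addrC -scaleNr reflP refl_alpha /refl.
by rewrite scaleNr scalerN opprK addrCA subrr addr0.
Qed.

Lemma iter_refl2P n s t a u v :
  iter n (refl s \o refl t) (a *: u + v) =
  a *: iter n (refl s \o refl t) u + iter n (refl s \o refl t) v.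
Proof. by elim: n => [//|n IH]; rewrite !iterS /= IH !reflP. Qed.

Lemma iter_refl2K n s t v :
  iter n (refl s \o refl t) (iter n (refl t \o refl s) v) = v.
Proof. by elim: n => [//|n IH]; rewrite iterSr iterS /= !reflK. Qed.

(** Each reflection advances the pair of coefficients by one step of the Chebyshev recursion. *)
Lemma iter_refl2_alpha n s t :
  iter n (refl s \o refl t) (alpha s) =
  cheb (coef s t) (n + n).+1 *: alpha s + cheb (coef s t) (n + n) *: alpha t.
Proof.
elim: n => [|n IH]; first by rewrite cheb1 cheb0 scale1r scale0r addr0.
rewrite iterS IH /= refl_alpha2 addrC refl_alpha2 addrC addSn addnS.
by rewrite coef_sym -!chebSS.
Qed.

(** These are the Coxeter relations that let W act on [V]. On the two simple roots they reduce to
    the Chebyshev values at 2 n and 2 n + 1. *)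
Lemma refl_relation s t n : m (val s) (val t) = Some n ->
  forall v, iter n (refl s \o refl t) v = v.
Proof.
move=> mst v; have [ts|st] := eqVneq t s.
  move: mst; rewrite ts (coxeter_m_diag cox (valP s)) => -[<-] /=.
  exact: reflK.
have mts : m (val t) (val s) = Some n by rewrite (coxeter_m_sym cox (valP t) (valP s)).
have n2 : (2 <= n)%N.
  by apply: (coxeter_m_ge2 cox (valP s) (valP t) _ mst); rewrite val_eqE eq_sym.
have [_ _ /(_ n n2) [c4 _ _ c0 c1]] := cosc.
have coefE : coef s t = c (Some n) by rewrite /coef mst.
have fix_alpha s' t' : m (val s') (val t') = Some n ->
    iter n (refl s' \o refl t') (alpha s') = alpha s'.
  move=> e; rewrite iter_refl2_alpha /coef e c0 c1.
  by rewrite scale1r scale0r addr0.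
have fix_s := fix_alpha _ _ mst.
have fix_t : iter n (refl s \o refl t) (alpha t) = alpha t.
  by rewrite -{1}(fix_alpha _ _ mts) iter_refl2K.
(* The plane spanned by alpha s and alpha t is nondegenerate as |coef s t| < 2,
   so v splits into a vector of this plane and one fixed by both reflections. *)
set k := coef s t in coefE.
have d0 : 4 - k ^+ 2 != 0 by rewrite subr_eq0 eq_sym coefE.
have [a [b [w [ws wt ->]]]] : exists a b w,
    [/\ cform w s = 0, cform w t = 0 & v = a *: alpha s + (b *: alpha t + w)].
  (* Cramer's rule for the system 2 a - k b = cform v s, 2 b - k a = cform v t, of determinant 4 -
     k^2. *)
  pose a := (2 * cform v s + k * cform v t) / (4 - k ^+ 2).
  pose b := (2 * cform v t + k * cform v s) / (4 - k ^+ 2).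
  exists a, b, ((- a) *: alpha s + ((- b) *: alpha t + v)).
  split; last by apply/ffunP => x; rewrite !ffunE /GRing.scale /=; ring.
    by rewrite !cformP !cform_alpha coef_diag (coef_sym t) -/k /a /b; field.
  by rewrite !cformP !cform_alpha coef_diag -/k /a /b; field.
have fix_w : iter n (refl s \o refl t) w = w.
  have stw : (refl s \o refl t) w = w.
    by rewrite /= {2}/refl wt scale0r subr0 /refl ws scale0r subr0.
  by elim: n {mst mts n2 c4 c0 c1 coefE fix_alpha fix_s fix_t} => [//|n IH];
    rewrite iterS IH.
by rewrite !iter_refl2P fix_s fix_t fix_w.
Qed.

Definition act : W -> V -> V := projT1 (cid (coxeter_action cox refl_relation)).

Lemma act1 v : act 1%g v = v.
Proof. by rewrite /act; case: cid => ? []. Qed.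

Lemma actM g h v : act (g * h)%g v = act g (act h v).
Proof. by rewrite /act; case: cid => ? []. Qed.

Lemma act_gen s v : act (val s) v = refl s v.
Proof. by rewrite /act; case: cid => ? []. Qed.

Lemma actK g v : act g^-1%g (act g v) = v.
Proof. by rewrite -actM mulVg act1. Qed.

Lemma actP g a u v : act g (a *: u + v) = a *: act g u + act g v.
Proof.
elim/(gen_ind cox): g a u v => [|g s IH] a u v; first by rewrite !act1.
by rewrite !actM !act_gen reflP IH.
Qed.

Lemma act0 g : act g 0 = 0.
Proof. by have := actP g (-1) 0 0; rewrite addr0 scaleN1r oppr0 scaleN1r addNr. Qed.

Lemma actZ g a v : act g (a *: v) = a *: act g v.
Proof. by have := actP g a v 0; rewrite act0 !addr0. Qed.

Lemma actD g u v : act g (u + v) = act g u + act g v.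
Proof. by have := actP g 1 u v; rewrite !scale1r. Qed.

Lemma actN g v : act g (- v) = - act g v.
Proof. by rewrite -scaleN1r actZ scaleN1r. Qed.

(* The alternating word of length k in s and t that ends in t. *)
Fixpoint altw s t k : seq S :=
  if k is k'.+1 then (if odd k' then s else t) :: altw s t k' else [::].

Lemma size_altw s t k : size (altw s t k) = k.
Proof. by elim: k => [//|k /= ->]. Qed.

Lemma ev_altwS s t k : ev (altw s t k.+1) = (ev (altw t s k) * val t)%g.
Proof.
elim: k => [|k IH]; first by rewrite /= ev_cons /ev !big_nil mulg1 mul1g.
rewrite [altw s t k.+2]/= ev_cons -/(altw s t k.+1) IH [altw t s k.+1]/= ev_cons.
by rewrite mulgA if_neg.
Qed.

Lemma ev_altw_even s t k : ev (altw s t k.*2) = ((val s * val t) ^+ k)%g.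
Proof.
elim: k => [|k IH]; first by rewrite /ev big_nil.
by rewrite doubleS /= odd_double /= !ev_cons IH expgS mulgA.
Qed.

(** The two alternating words begin with different letters, so the quotient is alternating of length
    2 k. For k = m(s,t) this turns the Coxeter relation into the braid relation. *)
Lemma ev_altwV s t k :
  ((ev (altw t s k))^-1 * ev (altw s t k))%g = ((val s * val t) ^+ k)%g.
Proof.
have inv_pow x y j : (((val x * val y) ^+ j)^-1)%g = ((val y * val x) ^+ j)%g.
  by rewrite -expVgn invgM !(genV cox).
rewrite -(odd_double_half k); case: (odd k); rewrite ?add0n ?add1n.
  rewrite /= odd_double /= !ev_cons !ev_altw_even invgM inv_pow (genV cox).
  by rewrite mulgA -(mulgA _ (val s)) -expgSr -expgnDr addSn addnn.
by rewrite !ev_altw_even inv_pow -expgnDr addnn.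
Qed.

Lemma braid s t n : m (val s) (val t) = Some n ->
  ev (altw s t n) = ev (altw t s n).
Proof.
move=> /(coxeter_relation cox); rewrite -ev_altwV => e.
by apply/esym; rewrite -[LHS]mulg1 -e mulVKg.
Qed.

(** Each letter is one step of the Chebyshev recursion; the parity of k records which root received
    the latest coefficient. *)
Lemma act_altw s t k :
  act (ev (altw s t k)) (alpha s) =
  cheb (coef s t) k.+1 *: alpha (if odd k then t else s) +
  cheb (coef s t) k *: alpha (if odd k then s else t).
Proof.
elim: k => [|k IH].
  by rewrite cheb1 cheb0 /ev big_nil act1 scale1r scale0r addr0.
rewrite [altw s t _]/= ev_cons actM IH act_gen refl_alpha2.
by rewrite [odd k.+1]/= !if_neg addrC chebSS; case: (odd k); rewrite // coef_sym.
Qed.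

Definition nonneg v := forall t, 0 <= v t.

Lemma nonneg_comb a b u v :
  0 <= a -> 0 <= b -> nonneg u -> nonneg v -> nonneg (a *: u + b *: v).
Proof.
by move=> a0 b0 u0 v0 t; rewrite !ffunE addr_ge0 // /GRing.scale /= mulr_ge0.
Qed.

Lemma nonneg_alpha s : nonneg (alpha s).
Proof. by move=> t; rewrite ffunE ler0n. Qed.

(* w = v * z, where z is a longest alternating word in s and t that can be
   split off at the right of w; v is then minimal in its coset of W_{s,t} and
   z maps alpha s into the cone spanned by alpha s and alpha t. *)
Theorem act_alpha_nonneg g s :
  (len g < len (g * val s)%g)%N -> nonneg (act g (alpha s)).
Proof.
have [n] := ubnP (len g); elim: n g s => [//|n IH] g s /ltnSE gn gs.
have [->|g1] := eqVneq g 1%g; first by rewrite act1; exact: nonneg_alpha.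
have [t gt] := len_descent cox g1.
have ts : t != s by apply: contraTneq gs => <-; rewrite -gt; lia.
pose Q k := `[< exists v : W, g = (v * ev (altw s t k))%g /\ len g = (len v + k)%N >].
have Q1 : Q 1%N.
  apply/asboolP; exists (g * val t)%g.
  by rewrite /= ev_cons /ev big_nil mulg1 (mulgenK cox) addn1.
have Qmax k : Q k -> (k <= len g)%N by move=> /asboolP [v [_ ->]]; exact: leq_addl.
have QS k : Q k.+1 -> Q k.
  move=> /asboolP [v [gv lv]]; apply/asboolP; set y := if odd k then s else t.
  exists (v * val y)%g; split; first by rewrite gv /= ev_cons mulgA.
  have := len_gen cox v y; have := len_mulr cox (v * val y)%g (altw s t k).
  by rewrite size_altw -mulgA -ev_cons -[_ :: _]/(altw s t k.+1) -gv lv; lia.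
have [k Qk kmax] := ex_maxnP (ex_intro (fun k => Q k) _ Q1) Qmax.
have k0 : (0 < k)%N := kmax _ Q1.
have /asboolP [v [gv lv]] := Qk.
have cheb_ge0 : 0 <= cheb (coef s t) k.+1 /\ 0 <= cheb (coef s t) k.
  rewrite /coef; case mst : (m _ _) => [p|]; last first.
    by have [-> _ _] := cosc; rewrite !cheb2 !ler0n.
  have p2 : (2 <= p)%N.
    by apply: (coxeter_m_ge2 cox (valP s) (valP t) _ mst); rewrite val_eqE eq_sym.
  suff kp : (k < p)%N.
    by have [_ _ /(_ p p2) [_ _ cge0 _ _]] := cosc; split; apply: cge0 => //; exact: ltnW.
  (* If k reached p = m(s,t), the braid relation would make the alternating tail of [g] end in [s],
     and [g * val s] would be shorter than [g]. *)
  rewrite ltnNge; apply/negP => pk.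
  have Qp : Q p.
    by move: Qk; rewrite -(subnK pk); elim: (k - p)%N => [//|j Hj]; rewrite addSn => /QS.
  have /asboolP [v' [gv' lv']] := Qp.
  case: p p2 {mst pk Qp} (braid mst) gv' lv' => [//|p] _ br gv' lv'.
  move: gs; rewrite lv' gv' br ev_altwS mulgA (mulgenK cox).
  move=> /leq_trans/(_ (len_mulr cox v' (altw s t p))).
  by rewrite size_altw; lia.
have step x : (len v < len (v * val x)%g)%N -> nonneg (act v (alpha x)).
  by apply: IH; lia.
rewrite gv actM act_altw actD !actZ.
have [c1 c2] := cheb_ge0.
(* A descent of [v] at the first letter of the alternating word would cancel there and shorten [g];
   a descent at the other letter would give [Q k.+1], against the maximality of [k]. *)
apply: nonneg_comb => //; apply: step; rewrite ltnNge; apply/negP => le.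
  have le' : (len (v * val (if odd k then t else s))%g).+1 = len v.
    by have := len_gen_cases cox v (if odd k then t else s); lia.
  case: k k0 {Qk kmax c1 c2 cheb_ge0 le} gv lv le' => [//|k] _.
  rewrite [altw _ _ _]/= [odd _]/= if_neg ev_cons mulgA; set x := if _ then _ else _.
  move=> gv lv le'; have := len_mulr cox (v * val x)%g (altw s t k).
  by rewrite size_altw -gv; lia.
set x := (if odd k then s else t) in le.
have le' : (len (v * val x)%g).+1 = len v.
  by have := len_gen_cases cox v x; lia.
suff /kmax : Q k.+1 by rewrite ltnn.
apply/asboolP; exists (v * val x)%g.
by rewrite /= -/x ev_cons mulgA (mulgenK cox); split; rewrite ?lv -?le' ?addSnnS.
Qed.

(** * Positive roots and inversion sets *)

Implicit Types (k : W).

Lemma nonneg_antisym v : nonneg v -> nonneg (- v) -> v = 0.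
Proof.
move=> v0 Nv0; apply/ffunP => t; apply/eqP; rewrite ffunE eq_le v0 andbT.
by have := Nv0 t; rewrite ffunE oppr_ge0.
Qed.

Lemma act_eq0 g v : act g v = 0 -> v = 0.
Proof. by move=> e; rewrite -(actK g v) e act0. Qed.

Lemma alpha_neq0 s : alpha s <> 0.
Proof.
move=> /ffunP/(_ s)/eqP; rewrite !ffunE eqxx.
by rewrite (oner_eq0 R).
Qed.

Lemma act_mulgen g s v : act (g * val s)%g v = act g (refl s v).
Proof. by rewrite actM act_gen. Qed.

Lemma act_alpha_sign g s : nonneg (act g (alpha s)) \/ nonneg (- act g (alpha s)).
Proof.
have [e|e] := len_gen_cases cox g s; [left|right].
  by apply: act_alpha_nonneg; rewrite e.
have : nonneg (act (g * val s)%g (alpha s)).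
  by apply: act_alpha_nonneg; rewrite (mulgenK cox) -e.
by rewrite act_mulgen refl_alpha actN.
Qed.

Lemma act_neg_len g s : nonneg (- act g (alpha s)) -> (len (g * val s)%g < len g)%N.
Proof.
move=> neg; have [e|<- //] := len_gen_cases cox g s.
have pos : nonneg (act g (alpha s)) by apply: act_alpha_nonneg; rewrite e.
by have /act_eq0/alpha_neq0 := nonneg_antisym pos neg.
Qed.

(** A nontrivial element has a descent s, and it sends [alpha s] to a negative root. *)
Lemma act_nonneg_eq1 g : (forall s, nonneg (act g (alpha s))) -> g = 1%g.
Proof.
move=> pos; apply: contrapT => /eqP /(len_descent cox) [s gs].
have : nonneg (act (g * val s)%g (alpha s)).
  by apply: act_alpha_nonneg; rewrite (mulgenK cox) -gs.
rewrite act_mulgen refl_alpha actN => neg.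
by have /act_eq0/alpha_neq0 := nonneg_antisym (pos s) neg.
Qed.

Lemma act_support (T : {fset W}) g v s :
  (T `<=` S)%fset -> parabolic T g -> val s \notin T -> act g v s = v s.
Proof.
move=> TS gT sT; pose fixes k := forall v, act k v s = v s.
apply: (parabolic_sub (T := T) (H := fixes)) gT v => [|t tT] /=.
  apply/group_setP; split=> [v|h k hs ks v|h hs v]; first by rewrite act1.
    by rewrite actM hs.
  by rewrite -hs -actM mulgV act1.
move=> v; have -> : t = val [` fsubsetP TS _ tT]%fset by [].
rewrite act_gen !ffunE /GRing.scale /=; case: eqP => [e|]; last by rewrite mulr0 subr0.
by rewrite e /= tT in sT.
Qed.

(** The reflection in [alpha s] changes the coordinate at [s], which elements of W_T leave alone
    when s lies outside T. *)
Lemma parabolicS (T : {fset W}) s :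
  (T `<=` S)%fset -> parabolic T (val s) -> val s \in T.
Proof.
move=> TS sT; apply/negPn/negP => nsT.
have := act_support (alpha s) TS sT nsT.
rewrite act_gen refl_alpha !ffunE eqxx => /eqP.
by rewrite -subr_eq0 -opprD oppr_eq0 (pnatr_eq0 R 2).
Qed.

Definition pos_root v := (exists g s, v = act g (alpha s)) /\ nonneg v.

Lemma root_sign g v : pos_root v -> nonneg (act g v) \/ nonneg (- act g v).
Proof. by move=> [[h [s ->]] _]; rewrite -actM; exact: act_alpha_sign. Qed.

Lemma root_neq0 v : pos_root v -> v <> 0.
Proof. by move=> [[h [s ->]] _] /act_eq0/alpha_neq0. Qed.

Lemma pos_root_act g v : pos_root v -> nonneg (act g v) -> pos_root (act g v).
Proof. by move=> [[h [s ->]] _]; split=> //; exists (g * h)%g, s; rewrite actM. Qed.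

Lemma pos_root_alpha s : pos_root (alpha s).
Proof. by split; [exists 1%g, s; rewrite act1|exact: nonneg_alpha]. Qed.

(** The invariant quadratic form 2 B(v, v), equal to 2 on roots. *)
Definition norm v : R := \sum_s v s * cform v s.

Lemma norm_refl s v : norm (refl s v) = norm v.
Proof.
rewrite /norm /refl addrC -scaleNr.
under eq_bigr => t _.
  rewrite cformP cform_alpha !ffunE /GRing.scale /=.
  have -> : (- cform v s * (t == s)%:R + v t) * (- cform v s * - coef s t + cform v t) =
    v t * cform v t + (cform v s * (v t * coef t s) +
    (t == s)%:R * (- cform v s * (cform v s * coef s t + cform v t))).
    by rewrite (coef_sym s t); ring.
  over.
rewrite !big_split /= -mulr_sumr [X in _ + (_ + X)](bigD1 s) //= eqxx.
rewrite [X in _ + (_ + (_ + X))]big1 => [|t /negbTE ->]; last by rewrite mul0r.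
rewrite coef_diag -[\sum_i _ * coef i s]opprK -/(cform v s) mulr1n; ring.
Qed.

Lemma norm_act g v : norm (act g v) = norm v.
Proof.
elim/(gen_ind cox): g v => [|g s IH] v; first by rewrite act1.
by rewrite act_mulgen IH norm_refl.
Qed.

Lemma norm_scale_alpha a s : norm (a *: alpha s) = a ^+ 2 * 2.
Proof.
rewrite /norm (bigD1 s) //= big1 ?addr0 => [|t /negbTE ts]; last first.
  by rewrite !ffunE ts /GRing.scale /= mulr0 mul0r.
rewrite -[a *: _]addr0 cformP !ffunE eqxx /GRing.scale /= cform_alpha.
have -> : cform 0 s = 0.
  by rewrite /cform big1 ?oppr0 // => t _; rewrite ffunE mul0r.
by rewrite coef_diag; ring.
Qed.

(** The reflection changes only the coordinate at [s], so a change of sign forces v to be a multiple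
    of [alpha s]; by invariance of the norm this multiple is [alpha s] itself. *)
Lemma pos_root_refl s v : pos_root v -> v <> alpha s -> pos_root (refl s v).
Proof.
move=> rv vs; rewrite -act_gen.
have [pos|neg] := root_sign (val s) rv; first exact: pos_root_act.
case: vs; have v0 t : t != s -> v t = 0.
  move=> ts; apply/eqP; rewrite eq_le (proj2 rv) andbT.
  have := neg t; rewrite act_gen !ffunE (negbTE ts) /GRing.scale /= mulr0 subr0.
  by rewrite oppr_ge0.
have vE : v = v s *: alpha s.
  apply/ffunP => t; rewrite !ffunE /GRing.scale /=.
  by have [->|/v0 ->] := eqVneq t s; rewrite ?mulr1 ?mulr0.
have [[h [t ve]] vpos] := rv.
have : norm v = 2 by rewrite ve norm_act -[alpha t]scale1r norm_scale_alpha; ring.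
rewrite vE norm_scale_alpha => n2.
have v1 : v s ^+ 2 = 1 ^+ 2 by lra.
move/eqP: v1; rewrite eqf_sqr => /orP [/eqP -> //|/eqP vs]; first by rewrite scale1r.
by have := vpos s; rewrite vs oppr_ge0 ler10.
Qed.

Definition inversions g : set V := [set v | pos_root v /\ nonneg (- act g v)].

(** Up to a reflection, one more generator adds at most the inversion [alpha s]. *)
Lemma finite_inversions g : finite_set (inversions g).
Proof.
elim/(gen_ind cox): g => [|g s IH].
  apply: (sub_finite_set (B := set0)) => // v [rv].
  by rewrite act1 => /(nonneg_antisym (proj2 rv)) /(root_neq0 rv).
apply: (@sub_finite_set _ _ ([set alpha s] `|` refl s @` inversions g)%classic).
  move=> v [rv]; rewrite act_mulgen => neg.
  have [->|vs] := pselect (v = alpha s); [by left|right].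
  by exists (refl s v); rewrite ?reflK //; split=> //; exact: pos_root_refl.
by rewrite finite_setU; split=> //; exact: finite_image.
Qed.

(** With equal inversion sets, g gives the same sign as h to the root that h maps to [alpha s];
    hence g h^-1 keeps all simple roots positive and is trivial. *)
Lemma inversions_sub_eq g h :
  (inversions g `<=` inversions h)%classic ->
  (inversions h `<=` inversions g)%classic -> g = h.
Proof.
move=> gh hg; suff : (g * h^-1 = 1)%g by move=> /divg1_eq.
apply: act_nonneg_eq1 => s; rewrite actM; set v := act h^-1%g (alpha s).
have hv : act h v = alpha s by rewrite -actM mulgV act1.
have [pos|neg] := act_alpha_sign h^-1%g s.
  have rv : pos_root v by split=> //; exists h^-1%g, s.
  have [//|negg] := root_sign g rv.
  have [_] : inversions h v by apply: gh.
  by rewrite hv => /(nonneg_antisym (nonneg_alpha s)) /alpha_neq0.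
have rv : pos_root (- v).
  split=> //; exists (h^-1 * val s)%g, s.
  by rewrite act_mulgen refl_alpha actN.
have [_] : inversions g (- v).
  by apply: hg; split=> //; rewrite actN opprK hv; exact: nonneg_alpha.
by rewrite actN opprK.
Qed.

(** An element is determined by its inversion set, and a finite set has finitely many subsets. *)
Lemma finite_inversions_bound (K : set W) (Z : set V) :
  finite_set Z -> (forall k, K k -> (inversions k `<=` Z)%classic) -> finite_set K.
Proof.
move=> /finite_fsetP [F ->] KZ.
pose f k := [fset v in F | `[< inversions k v >]]%fset.
apply: (@finite_set_inj _ _ _ f) => [g h /set_mem Kg /set_mem Kh fgh|].
  have sub k1 k2 : K k1 -> f k1 = f k2 -> (inversions k1 `<=` inversions k2)%classic.
    move=> K1 f12 v vk; have : v \in f k1.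
      by rewrite !inE /=; apply/andP; split; [exact: (KZ _ K1)|exact/asboolP].
    by rewrite f12 !inE => /andP [_ /asboolP].
  by apply: inversions_sub_eq; apply: sub.
apply: (finite_subfset (fpowerset F)) => _ [k _ <-] /=.
by rewrite fpowersetE; apply/fsubsetP => v; rewrite !inE => /andP [].
Qed.

(** * Chambers, stabilizers and finite subgroups *)

Lemma exists_chamber (f : V -> R) (L : seq V) :
  (forall v, f (- v) = - f v) ->
  (forall v, pos_root v -> f v < 0 -> v \in L) ->
  exists w, forall s, 0 <= f (act w (alpha s)).
Proof.
have [n] := ubnP (size L); elim: n f L => [//|n IH] f L /ltnSE Ln fN fL.
have [pos|] := pselect (forall s, 0 <= f (alpha s)).
  by exists 1%g => s; rewrite act1.
move=> /existsNP [s] /negP; rewrite -ltNge => fs.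
have sL : alpha s \in L by apply: fL fs; exact: pos_root_alpha.
(* The simple reflection permutes the positive roots other than [alpha s], so after replacing f by
   its reflection the list of possibly negative values loses [alpha s]. *)
have [|||w wpos] := IH (fun v => f (refl s v)) [seq refl s v | v <- rem (alpha s) L].
- rewrite size_map size_rem //; case: (L) sL Ln => //= *; lia.
- move=> v; rewrite -fN; congr f.
  by rewrite -!act_gen actN.
- move=> v rv fv; have vs : v <> alpha s.
    by move=> vs; move: fv; rewrite vs refl_alpha fN oppr_lt0 => /(lt_trans fs); rewrite ltxx.
  rewrite -(reflK s v); apply/map_f.
  have := fL _ (pos_root_refl rv vs) fv.
  rewrite (perm_mem (perm_to_rem sL)) inE => /orP [/eqP e|//].
  have : pos_root v by [].
  rewrite -(reflK s v) e refl_alpha => -[_ neg].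
  by have /alpha_neq0 := nonneg_antisym (nonneg_alpha s) neg.
by exists (val s * w)%g => t; rewrite actM act_gen.
Qed.

Section Functional.
Variable f : V -> R.
Hypothesis f_lin : forall a u v, f (a *: u + v) = a * f u + f v.

Lemma functional0 : f 0 = 0.
Proof. by have := f_lin (-1) 0 0; rewrite addr0 scaleN1r oppr0 mulN1r addNr. Qed.

Lemma functionalN v : f (- v) = - f v.
Proof. by have := f_lin (-1) v 0; rewrite !addr0 scaleN1r mulN1r functional0 addr0. Qed.

Lemma functional_sum v : f v = \sum_s v s * f (alpha s).
Proof.
have -> : f v = f (\sum_s v s *: alpha s).
  congr f; apply/ffunP => t; rewrite sum_ffunE (bigD1 t) //= big1 => [|s st].
    by rewrite !ffunE eqxx /GRing.scale /= mulr1 addr0.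
  by rewrite !ffunE eq_sym (negbTE st) /GRing.scale /= mulr0.
elim: (index_enum _) => [|s r IH]; first by rewrite !big_nil functional0.
by rewrite !big_cons f_lin IH.
Qed.

Lemma functional_ge0 v :
  (forall s, 0 <= f (alpha s)) -> nonneg v -> 0 <= f v.
Proof.
by move=> f0 v0; rewrite functional_sum sumr_ge0 // => s _; rewrite mulr_ge0.
Qed.

(** If k fixes f and makes [alpha s] negative, then f (alpha s) is both nonnegative and nonpositive,
    so s lies in J and can be split off from k; induction on the length finishes. *)
Lemma stabilizer_parabolic :
  (forall s, 0 <= f (alpha s)) ->
  exists2 J : {fset W}, (J `<=` S)%fset &
    (forall k, parabolic J k <-> forall v, f (act k v) = f v).
Proof.
move=> f0; pose J := [fset val s | s : S & f (alpha s) == 0]%fset.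
have JP s : f (alpha s) = 0 -> val s \in J.
  by move=> /eqP fs; apply/imfsetP; exists s; rewrite ?inE.
have f_refl s v : f (alpha s) = 0 -> f (refl s v) = f v.
  by move=> fs; rewrite /refl addrC -scaleNr f_lin fs mulr0 add0r.
exists J; first by apply/fsubsetP => _ /imfsetP [s _ ->]; exact: valP.
move=> k; split.
  apply: (parabolic_sub (H := [set k | forall v, f (act k v) = f v]%classic)).
    apply/group_setP; split=> [v|g h gf hf v|g gf v]; first by rewrite act1.
      by rewrite actM gf.
    by rewrite -gf -actM mulgV act1.
  move=> _ /imfsetP [s /= fs ->] v; rewrite act_gen f_refl //.
  by move: fs; rewrite inE => /eqP.
have [n] := ubnP (len k); elim: n k => [//|n IH] k /ltnSE kn kf.
have [->|k1] := pselect (k = 1%g); first exact: parabolic1.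
have /existsNP [s ns] : ~ forall s, nonneg (act k (alpha s)).
  by move=> /act_nonneg_eq1.
have [//|neg] := act_alpha_sign k s.
have fs : f (alpha s) = 0.
  apply/eqP; rewrite eq_le f0 andbT -oppr_ge0 -kf -functionalN.
  exact: functional_ge0.
rewrite -(mulgenK cox k s); apply: parabolicM; last exact: (parabolic_gen (JP s fs)).
apply: IH => [|v]; last by rewrite act_mulgen kf f_refl.
by apply: leq_trans kn; exact: (act_neg_len neg).
Qed.
End Functional.

(* The functional f sums, over h in H, the heights of the vectors h v: it is
   H-invariant and positive on all but finitely many positive roots. *)
Theorem finite_subgroup_parabolic (H : set W) :
  group_closed (mem H) -> finite_set H ->
  exists (w : W) (J : {fset W}),
    [/\ (J `<=` S)%fset, spherical J &
        forall h, H h -> parabolic J (w^-1 * h * w)%g].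
Proof.
move=> /group_setP [H1 HM HV] finH.
pose f v : R := \sum_(h <- fset_set H) \sum_s act h v s.
have f_lin a u v : f (a *: u + v) = a * f u + f v.
  rewrite /f mulr_sumr -big_split; apply: eq_bigr => h _ /=.
  rewrite mulr_sumr -big_split; apply: eq_bigr => s _ /=.
  by rewrite actP !ffunE.
have f_inv k v : H k -> f (act k v) = f v.
  move=> Hk.
  rewrite /f; under eq_bigr do under eq_bigr do rewrite -actM.
  (* Right translation by k permutes H, which reindexes the sum. *)
  rewrite -(big_map (fun h => h * k)%g xpredT (fun h => \sum_s act h v s)).
  apply: perm_big; apply: uniq_perm; rewrite ?fset_uniq //.
    by rewrite map_inj_uniq ?fset_uniq //; exact: mulIg.
  move=> h; apply/mapP/idP => [[g Hg ->]|Hh].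
    by move: Hg; rewrite !in_fset_set // => /set_mem Hg; apply/mem_set/HM.
  exists (h * k^-1)%g; rewrite ?mulgVK //.
  by move: Hh; rewrite !in_fset_set // => /set_mem Hh; apply/mem_set/HM/HV.
(* A positive root inverted by no element of H has only nonnegative heights in the sum, and the term
   of h = 1 is positive. *)
have f_pos v : pos_root v -> f v <= 0 -> exists2 h, H h & inversions h v.
  move=> rv fv; apply: contrapT => /forall2NP noinv; move: fv; apply/negP.
  have pos h : H h -> nonneg (act h v).
    move=> Hh; have [//|neg] := root_sign h rv.
    by have [/(_ Hh)|[]] := noinv h.
  rewrite -ltNge /f (bigD1_seq 1%g) ?fset_uniq //=; last by rewrite in_fset_set //; apply/mem_set.
  apply: ltr_pwDl; last first.
    rewrite big_seq_cond sumr_ge0 // => h /andP [Hh _]; rewrite sumr_ge0 // => s _.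
    by apply: pos; apply/set_mem; rewrite -in_fset_set.
  rewrite lt_def sumr_ge0 ?andbT => [|s _]; last by rewrite act1; apply: (proj2 rv).
  apply/eqP => /eqP; rewrite psumr_eq0 => [/allP v0|s _]; last first.
    by rewrite act1; apply: (proj2 rv).
  apply: (root_neq0 rv); apply/ffunP => s; rewrite ffunE.
  by have /eqP := v0 s (mem_index_enum s); rewrite act1.
pose Z : set V := (\bigcup_(h in H) inversions h)%classic.
have finZ : finite_set Z.
  by apply: bigcup_finite => // h _; exact: finite_inversions.
have fZ v : pos_root v -> f v <= 0 -> Z v.
  by move=> rv /(f_pos _ rv) [h Hh hv]; exists h.
have [L ZL] := (finite_seqP Z).1 finZ.
have [||w wpos] := exists_chamber (f := f) (L := L).
- by move=> v; rewrite functionalN.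
- by move=> v rv /ltW /(fZ _ rv); rewrite ZL.
pose g v := f (act w v).
have g_lin a u v : g (a *: u + v) = a * g u + g v by rewrite /g actP f_lin.
have [J JS JP] := stabilizer_parabolic g_lin wpos.
exists w, J; split=> // [|h Hh]; last first.
  by apply/JP => v; rewrite /g -actM !mulgA mulgV mul1g actM f_inv.
(* J is spherical: if k in W_J inverts v, then g v <= 0, since g is k-invariant and nonnegative on
   -k v. So w v is negative or one of the finitely many roots in Z. *)
apply: (@finite_inversions_bound _ (inversions w `|` act w^-1%g @` Z)%classic).
  rewrite finite_setU; split; first exact: finite_inversions.
  exact: finite_image.
move=> k /JP kg v [rv neg]; have [pos|negw] := root_sign w rv; last by left.
right; exists (act w v); last by rewrite actK.
apply: fZ; first exact: pos_root_act.
have : 0 <= g (- act k v) by apply: (functional_ge0 g_lin).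
by rewrite (functionalN g_lin) kg oppr_ge0.
Qed.

Lemma refl_alpha_neq s t : t != s -> refl s (alpha t) = alpha t + coef t s *: alpha s.
Proof.
move=> ts; have := refl_alpha2 t s 1 0.
by rewrite scale1r scale0r addr0 mulr1 subr0.
Qed.

(** The coordinates at [t] of s t (alpha s) and t s (alpha s) are [coef s t] and its opposite; so
    the cosine vanishes. *)
Lemma commute_m2 s t :
  (val s * val t = val t * val s)%g -> s <> t -> m (val s) (val t) = Some 2%N.
Proof.
move=> st /eqP nst; have := congr1 (fun g => act g (alpha s)) st.
rewrite /= !actM !act_gen refl_alpha refl_alpha_neq //.
rewrite -!act_gen actN actD actZ !act_gen.
rewrite refl_alpha !refl_alpha_neq // 1?eq_sym //.
move=> /ffunP /(_ t); rewrite !ffunE eq_sym (negbTE nst) eqxx /GRing.scale /=.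
rewrite (coef_sym t s) => e.
have {e} : coef s t = 0 by lra.
rewrite /coef; case e : (m _ _) => [n|]; have [c2 _ cn] := cosc.
  have n2 : (2 <= n)%N by apply: (coxeter_m_ge2 cox (valP s) (valP t) _ e); rewrite val_eqE.
  by have [_ h _ _ _] := cn n n2; move=> /h ->.
by rewrite c2 => /eqP; rewrite pnatr_eq0.
Qed.

(** For m(s,t) = infinity the powers of s t send [alpha s] to vectors with the distinct coordinates
    2 n + 1 at [s]. *)
Lemma spherical_m_neq_None s t :
  spherical [fset val s; val t]%fset -> m (val s) (val t) <> None.
Proof.
move=> fin e; have ce : coef s t = 2 by rewrite /coef e; case: cosc.
have actX n : act ((val s * val t) ^+ n)%g (alpha s) =
    (n + n).+1%:R *: alpha s + (n + n)%:R *: alpha t.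
  rewrite -[(n + n).+1%:R]cheb2 -[(n + n)%:R]cheb2 -ce -iter_refl2_alpha.
  elim: n => [|n IH]; first by rewrite expg0 act1.
  by rewrite expgS actM IH actM !act_gen.
have st : s != t.
  apply: contra_eqN e => /eqP <-; by rewrite (coxeter_m_diag cox (valP s)).
apply: infinite_nat; apply: (@finite_set_inj _ _ _ (fun n => (val s * val t) ^+ n)%g).
  move=> i j _ _ /(congr1 (fun g => act g (alpha s) s)).
  rewrite /= !actX !ffunE eqxx (negbTE st) /GRing.scale /= !mulr0 !addr0 !mulr1.
  by move/eqP; rewrite eqr_nat => /eqP; lia.
apply: sub_finite_set fin => _ [n _ <-].
elim: n => [|n IH]; first exact: parabolic1.
rewrite expgS; apply: parabolicM => //.
by apply: parabolicM; apply: parabolic_gen; rewrite !inE eqxx ?orbT.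
Qed.

(** * Centralizer of a central involution of a rank two parabolic subgroup *)

Section Centralizer.
Variables (p q : S).
Hypothesis pq : p != q.
Local Notation D := ([fset val p; val q]%fset : {fset W}).

Lemma pair_sub : (D `<=` S)%fset.
Proof. by apply/fsubsetP => x; rewrite !inE => /orP [/eqP ->|/eqP ->]; exact: valP. Qed.

Lemma notin_pair t : t != p -> t != q -> val t \notin D.
Proof. by move=> tp tq; rewrite !inE !val_eqE negb_or tp tq. Qed.

(** Every other simple root [alpha t] keeps its coordinate 1 at [t] under W_{p,q}, hence stays
    positive. *)
Lemma parabolic_nonneg_eq1 k : parabolic D k ->
  nonneg (act k (alpha p)) -> nonneg (act k (alpha q)) -> k = 1%g.
Proof.
move=> Dk kp kq; apply: act_nonneg_eq1 => t.
have [->//|tp] := eqVneq t p; have [->//|tq] := eqVneq t q.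
have [//|/(_ t)] := act_alpha_sign k t.
rewrite ffunE (act_support (alpha t) pair_sub Dk (notin_pair tp tq)) ffunE eqxx.
by rewrite oppr_ge0 ler10.
Qed.

Lemma act_gen_alpha_nonneg s t : t != s -> nonneg (act (val s) (alpha t)).
Proof.
move=> ts; have [//|/(_ t)] := act_alpha_sign (val s) t.
rewrite act_gen !ffunE eqxx (negbTE ts) /GRing.scale /= mulr0 subr0.
by rewrite oppr_ge0 ler10.
Qed.

(** The vector k (alpha s) lies in the (-1)-eigenspace of [refl s], which is a line. *)
Lemma commute_act_alpha k s :
  (k * val s = val s * k)%g -> exists a, act k (alpha s) = a *: alpha s.
Proof.
move=> ks; exists (act k (alpha s) s); set v := act k (alpha s).
have : refl s v = - v by rewrite -act_gen -actM -ks act_mulgen refl_alpha actN.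
move=> /ffunP e; apply/ffunP => t; have := e t; rewrite !ffunE /GRing.scale /=.
by have [->|ts] := eqVneq t s; rewrite ?mulr1 ?mulr0 // => {}e; lra.
Qed.

Variable x : W.
Hypotheses (Dx : parabolic D x) (xx : (x * x = 1)%g) (x1 : x <> 1%g).
Hypotheses (xp : (x * val p = val p * x)%g) (xq : (x * val q = val q * x)%g).
Hypothesis x_nrefl : ~ reflection S x.

Lemma act_x_alpha s : (x * val s = val s * x)%g ->
  act x (alpha s) = alpha s \/ act x (alpha s) = - alpha s.
Proof.
move=> xs; have [a ae] := commute_act_alpha xs.
have /eqP : a * a = 1.
  have /ffunP/(_ s) : act x (act x (alpha s)) = alpha s by rewrite -actM xx act1.
  by rewrite ae actZ ae !ffunE eqxx /GRing.scale /= mulr1.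
rewrite -expr2 sqrf_eq1 ae => /orP [] /eqP ->; [left|right];
  by rewrite ?scaleN1r ?scale1r.
Qed.

Lemma x_neq s : x <> val s.
Proof.
move=> e; apply: x_nrefl; exists 1%g, (val s); split; first exact: valP.
by rewrite e invg1 mulg1 mul1g.
Qed.

(** If x fixed both roots it would be trivial; if it negated only one, it would be the corresponding
    generator, a reflection. *)
Lemma act_x_plane : act x (alpha p) = - alpha p /\ act x (alpha q) = - alpha q.
Proof.
have [ep|ep] := act_x_alpha xp; have [eq|eq] := act_x_alpha xq; split=> //; exfalso.
- by apply: x1; apply: parabolic_nonneg_eq1; rewrite ?ep ?eq //; exact: nonneg_alpha.
- by apply: x1; apply: parabolic_nonneg_eq1; rewrite ?ep ?eq //; exact: nonneg_alpha.
- have : (val q * x = 1)%g.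
    apply: parabolic_nonneg_eq1; first exact: parabolicM (@parabolic_fset2r _ _ _) Dx.
      by rewrite actM ep; exact: act_gen_alpha_nonneg.
    by rewrite actM eq actN act_gen refl_alpha opprK; exact: nonneg_alpha.
  by move/mulg1_eq; rewrite (genV cox) => /esym /x_neq.
- have : (val p * x = 1)%g.
    apply: parabolic_nonneg_eq1; first exact: parabolicM (@parabolic_fset2l _ _ _) Dx.
      by rewrite actM ep actN act_gen refl_alpha opprK; exact: nonneg_alpha.
    by rewrite actM eq; apply: act_gen_alpha_nonneg; rewrite eq_sym.
  by move/mulg1_eq; rewrite (genV cox) => /esym /x_neq.
Qed.

Lemma plane_exp v : (forall t, t != p -> t != q -> v t = 0) ->
  v = v p *: alpha p + v q *: alpha q.
Proof.
move=> v0; apply/ffunP => t; rewrite !ffunE /GRing.scale /=.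
have [->|tp] := eqVneq t p; first by rewrite (negbTE pq) mulr1 mulr0 addr0.
by have [->|tq] := eqVneq t q; rewrite ?mulr1 ?mulr0 ?add0r // v0.
Qed.

Lemma planeP v : act x v = - v <-> forall t, t != p -> t != q -> v t = 0.
Proof.
split=> [e t tp tq|v0].
  have := act_support v pair_sub Dx (notin_pair tp tq).
  by rewrite e ffunE => {}e; lra.
by rewrite (plane_exp v0) actD !actZ !(proj1 act_x_plane, proj2 act_x_plane) !scalerN opprD.
Qed.

(* An element g of the centralizer preserves the (-1)-eigenspace of x, which is
   the plane spanned by alpha p and alpha q.  If g makes these two roots positive and alpha r
   negative, then it makes negative all positive roots of W_{p,q,r} outside of
   the plane, so that W_{p,q,r} is finite. *)
Theorem centralizer_parabolic :
  (forall r, r != p -> r != q -> ~ spherical [fset val p; val q; val r]%fset) ->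
  forall g, (g * x = x * g)%g -> parabolic D g.
Proof.
move=> nspher g; have [n] := ubnP (len g); elim: n g => [//|n IH] g /ltnSE gn gx.
have descent s : parabolic D (val s) -> (x * val s = val s * x)%g ->
    nonneg (- act g (alpha s)) -> parabolic D g.
  move=> Ds xs neg; rewrite -(mulgenK cox g s); apply: parabolicM => //.
  apply: IH; last by rewrite -mulgA -xs !mulgA gx.
  by apply: leq_trans gn; exact: (act_neg_len neg).
have [gp|] := act_alpha_sign g p; last by apply: descent xp => //; exact: parabolic_fset2l.
have [gq|] := act_alpha_sign g q; last by apply: descent xq => //; exact: parabolic_fset2r.
have [->|g1] := pselect (g = 1%g); first exact: parabolic1.
have /existsNP [r nr] : ~ forall s, nonneg (act g (alpha s)).
  by move=> /act_nonneg_eq1.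
have [//|gr] := act_alpha_sign g r.
have rp : r != p by apply/eqP => e; apply: nr; rewrite e.
have rq : r != q by apply/eqP => e; apply: nr; rewrite e.
have plane_act h v : (h * x = x * h)%g ->
    (forall t, t != p -> t != q -> v t = 0) -> forall t, t != p -> t != q -> act h v t = 0.
  by move=> hx /planeP v0; apply/planeP; rewrite -actM -hx actM v0 actN.
have alpha_plane s : (s == p) || (s == q) -> forall t, t != p -> t != q -> alpha s t = 0.
  by move=> spq t tp tq; rewrite ffunE; case/orP: spq => /eqP ->;
    rewrite ?(negbTE tp) ?(negbTE tq).
(* Otherwise the nonpositive vector g (alpha r) would lie in the plane, and so would [alpha r],
   because g^-1 preserves the plane. *)
have [t [tp tq tr]] : exists t, [/\ t != p, t != q & act g (alpha r) t < 0].
  apply: contrapT => /forallNP not; have := plane_act g^-1%g (act g (alpha r)).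
  rewrite actK => /(_ _ _ r rp rq); rewrite ffunE eqxx => h.
  suff /eqP : (1 : R) = 0 by rewrite oner_eq0.
  apply: h => [|t tp tq].
    by apply: (mulgI g); rewrite mulVKg mulgA gx mulgK.
  apply/eqP; rewrite eq_le; apply/andP; split.
    by have := gr t; rewrite ffunE oppr_ge0.
  by rewrite leNgt; apply/negP => neg; apply: (not t).
case: (nspher r rp rq).
apply: (finite_inversions_bound (Z := (inversions x `|` inversions g)%classic)).
  by rewrite finite_setU; split; exact: finite_inversions.
set E := [fset _; _; _]%fset => k Ek v [rv neg].
have ES : (E `<=` S)%fset.
  apply/fsubsetP => y; rewrite !inE -orbA => /or3P [] /eqP ->; exact: valP.
have vE s : s != p -> s != q -> s != r -> v s = 0.
  move=> sp sq sr; apply/eqP; rewrite eq_le (proj2 rv) andbT.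
  have sE : val s \notin E by rewrite !inE !val_eqE !negb_or sp sq sr.
  by have := neg s; rewrite ffunE (act_support v ES Ek sE) oppr_ge0.
have vr0 : 0 <= v r := proj2 rv r.
(* A root in the plane is negated by [x]. Any other one is inverted by [g]: at [t] its image has
   only the negative contribution of [alpha r]. *)
have [vr|vr] := eqVneq (v r) 0.
  left; split=> //; have -> : act x v = - v.
    by apply/planeP => s sp sq; have [->//|sr] := eqVneq s r; apply: vE.
  by rewrite opprK; exact: (proj2 rv).
right; split=> //; have [pos|//] := root_sign g rv.
have := pos t; suff -> : act g v t = v r * act g (alpha r) t.
  by rewrite pmulr_rge0 ?leNgt ?tr // lt_def vr.
have vexp : v = v r *: alpha r + (v p *: alpha p + v q *: alpha q).
  apply/ffunP => s; rewrite !ffunE /GRing.scale /=.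
  have [->|sr] := eqVneq s r; first by rewrite (negbTE rp) (negbTE rq) !mulr0 mulr1 !addr0.
  have [->|sp] := eqVneq s p; first by rewrite (negbTE pq) !mulr0 mulr1 addr0 add0r.
  by have [->|sq] := eqVneq s q; rewrite ?mulr1 ?mulr0 ?add0r // vE.
rewrite [in LHS]vexp actD !actZ actD !actZ !ffunE /GRing.scale /=.
have gs0 s : (s == p) || (s == q) -> act g (alpha s) t = 0.
  by move=> spq; apply: (plane_act _ _ gx (alpha_plane s spq)).
by rewrite (gs0 p) ?eqxx // (gs0 q) ?eqxx ?orbT // !mulr0 !addr0.
Qed.

End Centralizer.
End GeometricRepresentation.

(** * Dihedral and two-dimensional Coxeter groups *)

Local Open Scope fset_scope.
Local Open Scope classical_set_scope.
Local Open Scope group_scope.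

Section InvolutionSubgroups.
Variable G : groupType.
Implicit Types (T : {fset G}) (a b x y : G).

Lemma involV a : a * a = 1 -> a^-1 = a.
Proof. exact: mulg1_eq. Qed.

Lemma parabolic_ind T (P : G -> Prop) :
  (forall t, t \in T -> t * t = 1) -> P 1 ->
  (forall x t, t \in T -> P x -> P (x * t)) ->
  forall x, parabolic T x -> P x.
Proof.
move=> T2 P1 PT x Tx.
(* The elements x such that right multiplication by x and by its inverse preserves P form a
   subgroup. *)
suff /(_ 1 P1) [+ _] : forall y, P y -> P (y * x) /\ P (y * x^-1) by rewrite mul1g.
move: x Tx.
apply: (parabolic_sub (H := [set x | forall y, P y -> P (y * x) /\ P (y * x^-1)])).
  apply/group_setP; split=> [y|x z Hx Hz y Py|x Hx y Py].
  - by rewrite invg1 mulg1.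
  - split; first by rewrite mulgA; apply: (Hz _ (Hx _ Py).1).1.
    by rewrite invgM mulgA; apply: (Hx _ (Hz _ Py).2).2.
  - by rewrite invgK; have [] := Hx _ Py.
by move=> t tT y Py; rewrite (involV (T2 _ tT)); split; apply: PT.
Qed.

Lemma conjg_commute x y w :
  x * y = y * x <-> x ^ w * y ^ w = y ^ w * x ^ w.
Proof. by rewrite -!conjMg; split=> [->//|/conjg_inj]. Qed.

Lemma parabolic_fset0 x : parabolic fset0 x -> x = 1.
Proof. exact: (@parabolic_ind fset0 (fun x => x = 1)). Qed.

Lemma parabolic_fset1 a x : a * a = 1 -> parabolic [fset a] x -> x = 1 \/ x = a.
Proof.
move=> aa; apply: (parabolic_ind (P := fun x => x = 1 \/ x = a)) => [t||y t].
- by rewrite inE => /eqP ->.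
- by left.
- by rewrite inE => /eqP -> [] ->; rewrite ?mul1g ?aa; [right|left].
Qed.

Lemma parabolic_commute T z :
  (forall t, t \in T -> t * z = z * t) -> forall x, parabolic T x -> x * z = z * x.
Proof.
move=> Tz; apply: (parabolic_sub (H := [set x | x * z = z * x])) => //.
apply/group_setP; split=> [|x y xz yz|x xz]; first by rewrite /= mulg1 mul1g.
  by rewrite /= -mulgA yz mulgA xz mulgA.
by apply: (mulgI x); rewrite mulVKg mulgA xz mulgK.
Qed.

Section Dihedral.
Variables a b : G.
Hypotheses (aa : a * a = 1) (bb : b * b = 1).

Lemma mulaK x : x * a * a = x.
Proof. by rewrite -mulgA aa mulg1. Qed.

Lemma mulbK x : x * b * b = x.
Proof. by rewrite -mulgA bb mulg1. Qed.

(** Exponents are natural numbers, so powers of b a stand for the negative powers of a b. *)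
Definition rotation x := exists n, x = (a * b) ^+ n \/ x = (b * a) ^+ n.

Lemma rotationMab x : rotation x -> rotation (x * (a * b)).
Proof.
move=> [n [->|->]]; first by exists n.+1; left; rewrite expgSr.
case: n => [|n]; first by exists 1%N; left; rewrite expg0 mul1g expg1.
by exists n; right; rewrite expgSr !mulgA mulaK mulbK.
Qed.

Lemma rotationMba x : rotation x -> rotation (x * (b * a)).
Proof.
move=> [n [->|->]]; last by exists n.+1; right; rewrite expgSr.
case: n => [|n]; first by exists 1%N; right; rewrite expg0 mul1g expg1.
by exists n; left; rewrite expgSr !mulgA mulbK mulaK.
Qed.

Lemma dihedral_elt x :
  parabolic [fset a; b] x -> rotation x \/ exists2 y, rotation y & x = y * a.
Proof.
apply: (parabolic_ind (P := fun x => rotation x \/ exists2 y, rotation y & x = y * a)).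
- by move=> t; rewrite !inE => /orP [] /eqP ->.
- by left; exists 0%N; left.
move=> y t; rewrite !inE => /orP [] /eqP -> [ry|[z rz ->]].
- by right; exists y.
- by left; rewrite mulaK.
- by right; exists (y * (b * a)); [exact: rotationMba|rewrite mulgA mulaK].
- by left; rewrite -mulgA; exact: rotationMab.
Qed.

Lemma alternate_pow x y n : x * (y * x) ^+ n = (x * y) ^+ n * x.
Proof.
elim: n => [|n IH]; first by rewrite !expg0 mulg1 mul1g.
by rewrite expgSr [in RHS]expgSr !mulgA IH.
Qed.

Lemma expabV n : ((a * b) ^+ n)^-1 = (b * a) ^+ n.
Proof. by rewrite -expVgn invgM !involV. Qed.

Lemma expbaV n : ((b * a) ^+ n)^-1 = (a * b) ^+ n.
Proof. by rewrite -expVgn invgM !involV. Qed.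

Lemma rotation_inverted x : rotation x -> a * x * a = x^-1.
Proof.
move=> [n [->|->]]; first by rewrite expabV -mulgA -alternate_pow mulgA aa mul1g.
by rewrite expbaV alternate_pow mulaK.
Qed.

(** Outside the rotations an element is, after cancellation, an alternating word of odd length; this
    palindrome is a conjugate of its middle letter, selected by the parity of [n]. *)
Lemma dihedral_reflection x : parabolic [fset a; b] x -> rotation x \/
  exists y, parabolic [fset a; b] y /\ (x = y * a * y^-1 \/ x = y * b * y^-1).
Proof.
have Da := @parabolic_fset2l _ a b; have Db := @parabolic_fset2r _ a b.
have Dexp y n : parabolic [fset a; b] y -> parabolic [fset a; b] (y ^+ n).
  move=> Dy; elim: n => [|n IH]; first exact: parabolic1.
  by rewrite expgS; exact: parabolicM.
have Dab n : parabolic [fset a; b] ((a * b) ^+ n) by exact: Dexp (parabolicM Da Db).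
have Dba n : parabolic [fset a; b] ((b * a) ^+ n) by exact: Dexp (parabolicM Db Da).
move=> /dihedral_elt [|[_ [n [->|->]] ->]]; [by left|right|right].
  rewrite -(odd_double_half n) -addnn; set k := n./2; case: (odd n) => /=.
    exists ((a * b) ^+ k * a); split; first exact: parabolicM (Dab k) Da.
    right; rewrite invgM expabV (involV aa) alternate_pow -(mulgA _ a b) -expgSr.
    by rewrite mulgA -expgnDr add1n addSn.
  exists ((a * b) ^+ k); split=> //; left.
  by rewrite expabV -mulgA alternate_pow mulgA -expgnDr.
rewrite -(odd_double_half n) -addnn; set k := n./2; case: (odd n) => /=.
  exists ((b * a) ^+ k); split=> //; right.
  by rewrite expbaV -mulgA alternate_pow mulgA add1n expgSr -expgnDr !mulgA mulaK.
exists ((b * a) ^+ k); split=> //; left; rewrite expbaV -mulgA.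
rewrite -(mulaK (a * (a * b) ^+ k)) rotation_inverted; last by exists k; left.
by rewrite expabV mulgA -expgnDr.
Qed.

Lemma dihedral_finite n :
  (0 < n)%N -> (a * b) ^+ n = 1 -> spherical [fset a; b].
Proof.
move=> n0 abn; have ban : (b * a) ^+ n = 1 by rewrite -expabV abn invg1.
have expM x : x ^+ n = 1 -> forall k, x ^+ k = x ^+ (k %% n).
  by move=> xn k; rewrite {1}(divn_eq k n) expgnDr mulnC expgnA xn expg1n mul1g.
pose Rot := (fun k => (a * b) ^+ k) @` `I_n `|` (fun k => (b * a) ^+ k) @` `I_n.
have finRot : finite_set Rot.
  by rewrite finite_setU; split; apply/finite_image/finite_II.
apply: (@sub_finite_set _ _ (Rot `|` (fun y => y * a) @` Rot)); last first.
  by rewrite finite_setU; split=> //; exact: finite_image.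
have rotR y : rotation y -> Rot y.
  move=> [k [->|->]]; [left|right]; exists (k %% n)%N; rewrite /= ?ltn_mod //.
    by rewrite -expM.
  by rewrite -expM.
by move=> x /dihedral_elt [/rotR|[y /rotR Ry ->]]; [left|right; exists y].
Qed.

End Dihedral.

Lemma parabolic_klein a b x : a * a = 1 -> b * b = 1 -> a * b = b * a ->
  parabolic [fset a; b] x -> [\/ x = 1, x = a, x = b | x = a * b].
Proof.
move=> aa bb ab.
apply: (parabolic_ind (P := fun x => [\/ x = 1, x = a, x = b | x = a * b])).
- by move=> t; rewrite !inE => /orP [] /eqP ->.
- by constructor.
move=> y t; rewrite !inE => /orP [] /eqP -> [] ->; rewrite ?mul1g ?aa ?bb.
- by apply: Or42.
- by apply: Or41.
- by apply: Or44.
- by rewrite ab mulaK //; apply: Or43.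
- by apply: Or43.
- by apply: Or44.
- by apply: Or41.
- by rewrite mulaK //; apply: Or42.
Qed.

End InvolutionSubgroups.

(** * Generators, parabolic subgroups and dimension of a Coxeter system *)

Section CoxeterFacts.
Variables (W : groupType) (S : {fset W}) (m : W -> W -> option nat).
Hypothesis cox : coxeter_system S m.
Implicit Types (s t p q r x y : W) (T J : {fset W}).

Lemma gen_sq s : s \in S -> s * s = 1.
Proof. by move=> sS; exact: (genK cox [` sS]). Qed.

Lemma reflection_sign : exists chi : W -> bool,
  [/\ {morph chi : g h / g * h >-> g (+) h}, forall s, s \in S -> chi s &
      forall r, reflection S r -> chi r].
Proof.
have [chi [chiM chi_gen]] := exists_sign cox.
have chiS s : s \in S -> chi s by move=> sS; rewrite (chi_gen [` sS]).
exists chi; split=> // r [w [s [sS ->]]].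
have := chiM w w^-1; rewrite mulgV !chiM (chiS _ sS).
by have := chiM 1 1; rewrite mulg1; case: (chi 1); case: (chi w); case: (chi w^-1).
Qed.

Lemma gen_neq1 s : s \in S -> s <> 1.
Proof.
move=> sS s1; have [chi [chiM chiS _]] := reflection_sign.
by have := chiM 1 1; rewrite mulg1 -s1 chiS.
Qed.

Lemma gen_relation s t n : s \in S -> t \in S -> m s t = Some n -> (s * t) ^+ n = 1.
Proof. by move=> sS tS; exact: (@coxeter_relation _ _ _ cox [` sS] [` tS]). Qed.

Lemma gen_commute_m s t : s \in S -> t \in S -> s <> t -> s * t = t * s ->
  m s t = Some 2.
Proof.
move=> sS tS st e; have [R [c cosc]] := exists_cosine_family.
by apply: (commute_m2 cox cosc (s := [` sS]) (t := [` tS])) => // -[].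
Qed.

Lemma spherical_m s t : s \in S -> t \in S -> spherical [fset s; t] -> m s t <> None.
Proof.
move=> sS tS; have [R [c cosc]] := exists_cosine_family.
exact: (spherical_m_neq_None cox cosc (s := [` sS]) (t := [` tS])).
Qed.

Lemma parabolic_gens T s : (T `<=` S)%fset -> s \in S -> parabolic T s -> s \in T.
Proof.
move=> TS sS; have [R [c cosc]] := exists_cosine_family.
exact: (parabolicS cox cosc (s := [` sS])).
Qed.

Lemma finite_subgroup_conj (H : set W) : group_closed (mem H) -> finite_set H ->
  exists (w : W) (J : {fset W}),
    [/\ (J `<=` S)%fset, spherical J & forall h, H h -> parabolic J (h ^ w)].
Proof.
move=> gH finH; have [R [c cosc]] := exists_cosine_family.
have [w [J [JS sJ HJ]]] := finite_subgroup_parabolic cox cosc gH finH.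
by exists w, J; split=> // h Hh; rewrite conjgE mulgA; exact: HJ.
Qed.

Lemma parabolic_mono T T' x : (T `<=` T')%fset -> parabolic T x -> parabolic T' x.
Proof.
move=> TT'; apply: (parabolic_sub (H := parabolic T')) x => [|t tT].
  exact: parabolic_closed.
by apply: parabolic_gen; exact: (fsubsetP TT').
Qed.

Lemma parabolic_inj T T' :
  (T `<=` S)%fset -> (T' `<=` S)%fset -> parabolic T = parabolic T' -> T = T'.
Proof.
move=> TS T'S e; apply/fsetP => t; apply/idP/idP => tT.
  apply: parabolic_gens => //; first exact: (fsubsetP TS).
  by rewrite -e; exact: parabolic_gen.
apply: parabolic_gens => //; first exact: (fsubsetP T'S).
by rewrite e; exact: parabolic_gen.
Qed.

(** The initial segments of an enumeration of T generate a strict chain of finite parabolic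
    subgroups, a simplex with |T| + 1 vertices. *)
Lemma davis_dim_spherical n T :
  davis_dim S n -> (T `<=` S)%fset -> spherical T -> (#|` T| <= n)%N.
Proof.
move=> [_ dim_le] TS finT; set w : seq W := T; set k := size w.
pose U (i : nat) := [fset x in take i w]%fset.
have inU i x : x \in U i = (x \in take i w) by rewrite inE.
have UT i : (U i `<=` T)%fset by apply/fsubsetP => x; rewrite inU => /mem_take.
have Ule i j : (i <= j)%N -> (U i `<=` U j)%fset.
  by move=> ij; apply/fsubsetP => x; rewrite !inU -(take_takel w ij) => /mem_take.
have cardU (i : 'I_k.+1) : #|` U i| = i.
  rewrite /U card_fseq undup_id ?take_uniq ?fset_uniq // size_take -/k.
  by case: ltnP => // ik; apply/eqP; rewrite eqn_leq ik -ltnS ltn_ord.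
pose f (i : 'I_k.+1) : set W := parabolic (U i).
have f_inj : injective f.
  move=> i j /parabolic_inj e; apply: val_inj; rewrite /= -(cardU i) -(cardU j).
  by rewrite e //; exact: fsubset_trans (UT _) TS.
have := dim_le [fset f i | i : 'I_k.+1]%fset.
rewrite card_imfset //= -cardE card_ord ltnS; apply; split.
- by rewrite -cardfs_gt0 card_imfset //= -cardE card_ord.
- move=> _ /imfsetP [i _ ->]; exists 1, (U i); split.
  + exact: fsubset_trans (UT i) TS.
  + by apply: sub_finite_set finT => x; exact: parabolic_mono.
  + apply/seteqP; split=> [x Ux|_ [x Ux <-]]; last by rewrite mul1g.
    by exists x; rewrite ?mul1g.
move=> _ _ /imfsetP [i _ ->] /imfsetP [j _ ->].
by have [ij|/ltnW ij] := leqP i j; [left|right] => x;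
  exact: (parabolic_mono (Ule _ _ ij)).
Qed.

End CoxeterFacts.

(** * Spherical subsets and involutions in dimension two *)

Section TwoDimensional.
Variables (W : groupType) (S : {fset W}) (m : W -> W -> option nat).
Hypotheses (cox : coxeter_system S m) (dim2 : davis_dim S 2).
Implicit Types (p q r s w z : W) (J : {fset W}).

Lemma reflectionJ z w : reflection S (z ^ w) -> reflection S z.
Proof.
move=> [v [s [sS e]]]; exists (w * v), s; split=> //.
by rewrite invgM -[z](conjgK w) e conjgE invgK !mulgA.
Qed.

Lemma spherical_cases J : (J `<=` S)%fset -> spherical J ->
  [\/ J = fset0%fset, exists2 a, a \in S & J = [fset a]%fset |
      exists a b, [/\ a \in S, b \in S, a != b & J = [fset a; b]%fset]].
Proof.
move=> JS /(davis_dim_spherical cox dim2 JS).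
case: (fset_0Vmem J) => [->|[a aJ]]; first by constructor 1.
have aS := fsubsetP JS _ aJ.
rewrite (cardfsD1 a) aJ add1n ltnS.
case: (fset_0Vmem (J `\ a)%fset) => [e _|[b]].
  constructor 2; exists a => //; apply/fsetP => x; rewrite !inE.
  have : x \in (J `\ a)%fset = false by rewrite e inE.
  by rewrite !inE; case: eqVneq => [->|].
rewrite !inE => /andP [ba bJ] le1; constructor 3; exists a, b.
split; rewrite // 1?eq_sym //; first exact: (fsubsetP JS).
apply/fsetP => x; apply/idP/idP; last by rewrite !inE => /orP [] /eqP ->.
move=> xJ; rewrite !inE; case: eqVneq => //= xa; apply/negPn/negP => xb.
move: le1; rewrite (cardfsD1 b) !inE ba bJ add1n ltnS leqn0 cardfs_eq0 => /eqP e.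
have : x \in ((J `\ a) `\ b)%fset by rewrite !inE xa xb xJ.
by rewrite e inE.
Qed.

Lemma spherical_triple p q r : p \in S -> q \in S -> r \in S ->
  p != q -> r != p -> r != q -> ~ spherical [fset p; q; r]%fset.
Proof.
move=> pS qS rS pq rp rq.
have TS : ([fset p; q; r] `<=` S)%fset.
  by apply/fsubsetP => x; rewrite !inE -orbA => /or3P [] /eqP ->.
move=> /(davis_dim_spherical cox dim2 TS).
by rewrite fsetUC cardfsU1 !inE negb_or rp rq cardfs2 pq.
Qed.

(* In a dihedral group an involution that is not a reflection is central. *)
Lemma nonreflection_involution (H : set W) z :
  group_closed (mem H) -> finite_set H -> H z ->
  z * z = 1 -> z <> 1 -> ~ reflection S z ->
  exists w a b,
    [/\ [/\ a \in S, b \in S, a != b & spherical [fset a; b]%fset],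
        forall h, H h -> parabolic [fset a; b]%fset (h ^ w) &
        forall g, parabolic [fset a; b]%fset (g ^ w) <-> g * z = z * g].
Proof.
move=> gH finH Hz zz z1 nz.
have [w [J [JS sJ HJ]]] := finite_subgroup_conj cox gH finH.
have Jz := HJ _ Hz; set x := z ^ w in Jz.
have xx : x * x = 1 by rewrite -conjMg zz conj1g.
have x1 : x <> 1 by move/eqP; rewrite conjg_eq1 => /eqP.
have nx : ~ reflection S x by move=> /reflectionJ.
have xS s : s \in S -> x <> s.
  by move=> sS e; apply: nx; exists 1, s; rewrite invg1 mulg1 mul1g.
have [J0|[a aS Ja]|[a [b [aS bS ab Jab]]]] := spherical_cases JS sJ.
- by case: x1; apply: parabolic_fset0; rewrite -J0.
- have aa := gen_sq cox aS; rewrite Ja in Jz.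
  by case: (parabolic_fset1 aa Jz) => // e; case: (xS _ aS).
exists w, a, b; rewrite Jab in Jz sJ HJ; split=> // g.
have aa := gen_sq cox aS; have bb := gen_sq cox bS.
(* As x is not a reflection it is a rotation, so a and b invert it; being its own inverse, it
   commutes with both. *)
have [xa xb] : a * x = x * a /\ b * x = x * b.
  have [rx|[y [_ yE]]] := dihedral_reflection aa bb Jz; last first.
    by case: nx; case: yE => ->; exists y; [exists a|exists b].
  have bax : b * x * b = x^-1.
    apply: (rotation_inverted bb aa); case: rx => n rx; exists n.
    by case: rx; [right|left].
  have := rotation_inverted aa bb rx; rewrite (mulg1_eq xx) in bax *.
  move=> axa; split; first by rewrite -{2}axa mulaK.
  by rewrite -{2}bax mulbK.
split=> [Dg|gz].
  apply/(conjg_commute _ _ w); apply: (parabolic_commute (T := [fset a; b]%fset)) => //.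
  by move=> t; rewrite !inE => /orP [] /eqP ->.
have [R [c cosc]] := exists_cosine_family.
apply: (@centralizer_parabolic _ _ _ cox _ _ cosc [` aS] [` bS] _ x) => //=.
- by move=> [r rS] ra rb; exact: spherical_triple.
- exact: (conjg_commute g z w).1 gz.
Qed.

End TwoDimensional.

(** * Isomorphisms *)

Lemma characterJ (G : groupType) (chi : G -> bool) :
  {morph chi : g h / g * h >-> g (+) h} -> forall x w, chi (x ^ w) = chi x.
Proof.
move=> chiM x w; rewrite conjgE !chiM.
have := chiM w^-1 w; have := chiM 1 1; rewrite mulVg mulg1.
by case: (chi 1); case: (chi w); case: (chi w^-1); case: (chi x).
Qed.

(** Every relation that links s to another generator has exponent 2, so the number of occurrences of
    s is well defined modulo 2. *)
Lemma generator_character (W : groupType) (S : {fset W}) m s :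
  coxeter_system S m -> s \in S ->
  (forall u n, u \in S -> u != s -> m s u = Some n -> n = 2) ->
  exists chi : W -> bool,
    {morph chi : g h / g * h >-> g (+) h} /\ forall u, u \in S -> chi u = (u == s).
Proof.
move=> cox sS m2.
have [|chi [chiM chi_gen]] := coxeter_character cox (p := fun u => val u == s).
  move=> u v n; have [us|us] := eqVneq (val u) s; have [vs|vs] := eqVneq (val v) s => //=.
    by rewrite us => /(m2 _ _ (valP v) vs) ->.
  by rewrite vs (coxeter_m_sym cox (valP u) sS) => /(m2 _ _ (valP u) us) ->.
by exists chi; split=> // u uS; exact: (chi_gen [` uS]).
Qed.

Section Isomorphism.
Variables (W W' : groupType) (S : {fset W}) (S' : {fset W'}).
Variables (m : W -> W -> option nat) (m' : W' -> W' -> option nat).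
Hypotheses (cox : coxeter_system S m) (cox' : coxeter_system S' m').
Hypotheses (dim2 : davis_dim S 2) (dim2' : davis_dim S' 2).
Variables (phi : W -> W') (psi : W' -> W).
Hypothesis phiM : {morph phi : x y / x * y}.
Hypotheses (phiK : cancel phi psi) (psiK : cancel psi phi).

Let phi_inj : injective phi := can_inj phiK.

Lemma morphic1 : phi 1 = 1.
Proof. by apply: (mulgI (phi 1)); rewrite -phiM !mulg1. Qed.

Lemma morphicV x : phi x^-1 = (phi x)^-1.
Proof. by apply/esym/mulg1_eq; rewrite -phiM mulgV morphic1. Qed.

Lemma morphic_commute x y : x * y = y * x <-> phi x * phi y = phi y * phi x.
Proof. by rewrite -!phiM; split=> [->//|/phi_inj]. Qed.

Lemma image_group (H : set W) :
  group_closed (mem H) -> group_closed (mem (phi @` H)).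
Proof.
move=> /group_setP [H1 HM HV]; apply/group_setP; split.
- by exists 1; rewrite ?morphic1.
- by move=> _ _ [x Hx <-] [y Hy <-]; exists (x * y); rewrite ?phiM //; exact: HM.
- by move=> _ [x Hx <-]; exists x^-1; rewrite ?morphicV //; exact: HV.
Qed.

Variable s : W.
Hypotheses (sS : s \in S) (phi_s : ~ reflection S' (phi s)).

Let C := [set g | g * s = s * g].

Let ss : s * s = 1 := gen_sq cox sS.

Let zz : phi s * phi s = 1.
Proof. by rewrite -phiM ss morphic1. Qed.

Let z1 : phi s <> 1.
Proof. by rewrite -morphic1 => /phi_inj; exact: (gen_neq1 cox). Qed.

Lemma centralizer_image : exists w a b,
  [/\ a \in S', b \in S', a != b, spherical [fset a; b]%fset &
      forall g, parabolic [fset a; b]%fset (phi g ^ w) <-> C g].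
Proof.
have finz : finite_set (parabolic [fset phi s]%fset).
  apply: (@sub_finite_set _ _ [set 1; phi s]); last exact: finite_set2.
  by move=> x /(parabolic_fset1 zz) [] ->; [left|right].
have zP : parabolic [fset phi s]%fset (phi s) by apply: parabolic_gen; rewrite !inE.
have [w [a [b [[aS bS ab sab] _ Cz]]]] := nonreflection_involution cox' dim2'
  (parabolic_closed _) finz zP zz z1 phi_s.
exists w, a, b; split=> // g.
by apply: (iff_trans (Cz _)); apply: iff_sym; exact: morphic_commute.
Qed.

(** The image of the finite dihedral group W_{s,u} lies in a conjugate of a rank two parabolic
    subgroup that is the whole centralizer of [phi s]. *)
Lemma finite_order_commute u : u \in S -> u != s -> m s u <> None -> C u.
Proof.
move=> uS us; case e : (m s u) => [n|//] _.
have n2 : (2 <= n)%N by apply: (coxeter_m_ge2 cox sS uS _ e); rewrite eq_sym.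
have sun := gen_relation cox sS uS e.
have fin : spherical [fset s; u]%fset.
  by apply: (dihedral_finite ss (gen_sq cox uS) _ sun); exact: ltnW.
have [|w [a [b [_ HD Cz]]]] := nonreflection_involution cox' dim2'
  (image_group (parabolic_closed [fset s; u]%fset)) (finite_image _ fin) _ zz z1 phi_s.
  by exists s => //; exact: parabolic_fset2l.
by apply/morphic_commute/Cz; apply: HD; exists u => //; exact: parabolic_fset2r.
Qed.

Lemma finite_order_m u n : u \in S -> u != s -> m s u = Some n -> n = 2.
Proof.
move=> uS us msu; have us' : C u by apply: finite_order_commute; rewrite ?msu.
suff : m s u = Some 2 by rewrite msu => -[].
by apply: (gen_commute_m cox) => //; apply/eqP; rewrite eq_sym.
Qed.

Lemma centralizer_conj : exists g t,
  [/\ t \in S, t != s, spherical [fset s; t]%fset, s ^ g = s &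
      forall h, C h -> parabolic [fset s; t]%fset (h ^ g)].
Proof.
have [w [a [b [aS bS ab sab CP]]]] := centralizer_image.
have gC : group_closed (mem C).
  apply/group_setP; rewrite /C /=; split=> [|x y xs ys|x xs]; first by rewrite mulg1 mul1g.
    by rewrite -mulgA ys mulgA xs mulgA.
  by apply: (mulgI x); rewrite mulVKg mulgA xs mulgK.
have finC : finite_set C.
  apply: (@finite_set_inj _ _ _ (fun g => phi g ^ w)).
    by move=> x y _ _ /conjg_inj /phi_inj.
  by apply: sub_finite_set sab => _ [g /CP Cg <-].
have Cs : C s by [].
have [v [K [KS sK CK]]] := finite_subgroup_conj cox gC finC.
have pre d : phi (psi (d ^ w^-1)) ^ w = d by rewrite psiK conjgKV.
have [K0|[k kS Kk]|[p [q [pS qS pq Kpq]]]] := spherical_cases cox dim2 KS sK.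
- have := CK _ Cs; rewrite K0 => /parabolic_fset0 /eqP.
  by rewrite conjg_eq1 => /eqP /(gen_neq1 cox sS).
(* A group of order two cannot contain the preimages of both [a] and [b]. *)
- have conj_k d : d \in S' -> parabolic [fset a; b]%fset d -> psi (d ^ w^-1) ^ v = k.
    move=> dS Dd; have Cd : C (psi (d ^ w^-1)) by apply/CP; rewrite pre.
    have := CK _ Cd; rewrite Kk => /(parabolic_fset1 (gen_sq cox kS)) [/eqP|//].
    rewrite conjg_eq1 => /eqP e; have := pre d.
    by rewrite e morphic1 conj1g => /esym /(gen_neq1 cox' dS).
  have := conj_k a aS (@parabolic_fset2l _ _ _).
  rewrite -(conj_k b bS (@parabolic_fset2r _ _ _)) => /conjg_inj /(can_inj psiK) /conjg_inj.
  by move/eqP; rewrite (negbTE ab).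
have [e [f [g [eS fS ef [sef sg CD]]]]] : exists e f g, [/\ e \in S, f \in S, e != f &
    [/\ spherical [fset e; f]%fset, s ^ g = e &
    forall h, C h -> parabolic [fset e; f]%fset (h ^ g)]].
  rewrite Kpq in sK CK.
  have [rot|[y [Dy yE]]] := dihedral_reflection (gen_sq cox pS) (gen_sq cox qS) (CK _ Cs).
    (* The sign character is trivial on rotations but not on [s]. *)
    have [chi [chiM chiS _]] := reflection_sign cox.
    have chi1 : chi 1 = false by have := chiM 1 1; rewrite mulg1; case: (chi 1).
    have chi_pow x n : chi x = false -> chi (x ^+ n) = false.
      by move=> x0; elim: n => [//|n IH]; rewrite expgS chiM x0 IH.
    have := characterJ chiM s v; rewrite (chiS s sS) => chi_s.
    by case: rot chi_s => n [->|->]; rewrite chi_pow // chiM !chiS.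
  have CD h : C h -> parabolic [fset p; q]%fset (h ^ (v * y)).
    move=> /CK Dh; rewrite conjgM conjgE; apply: parabolicM; first exact: parabolicV.
    exact: parabolicM.
  have conjy x : (y * x * y^-1) ^ y = x by rewrite conjgE mulgVK mulKg.
  case: yE => sE; [exists p, q, (v * y)|exists q, p, (v * y)].
    by split=> //; split=> //; rewrite conjgM sE conjy.
  rewrite eq_sym in pq; rewrite (fsetUC [fset p]%fset) in sK CD.
  by split=> //; split=> //; rewrite conjgM sE conjy.
have [chi [chiM chi_gen]] := generator_character cox sS finite_order_m.
have /eqP es : e == s by rewrite -chi_gen // -sg characterJ // chi_gen.
rewrite es in sg ef sef CD.
by exists g, f; split=> //; rewrite eq_sym.
Qed.

(** The existence part without the condition on the remaining values of m'; in this form it is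
    applied both to the given isomorphism and to its inverse. *)
Lemma nonreflection_generator : exists t s' t' w',
  [/\ t \in S, s' \in S', t' \in S' & s' != t'] /\
  [/\ m s t = Some 2, forall u, u \in S -> u != s -> u != t -> m s u = None &
      m' s' t' = Some 2] /\
  [/\ phi s ^ w' = s' * t', phi t ^ w' = t' &
      forall x, parabolic [fset s; t]%fset x <->
                parabolic [fset s'; t']%fset (phi x ^ w')].
Proof.
have [w [a [b [aS bS ab sab CP]]]] := centralizer_image.
have [g [t [tS ts sst sg CD]]] := centralizer_conj.
have Ct : C t.
  by apply: finite_order_commute => //; exact: (spherical_m cox sS tS sst).
have tt := gen_sq cox tS.
have mst : m s t = Some 2.
  by apply: (gen_commute_m cox) => //; apply/eqP; rewrite eq_sym.
have gs : C g by rewrite /C /= [RHS]conjgC sg.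
have sgV : s ^ g^-1 = s by rewrite -{1}sg conjgK.
have CE h : C h <-> parabolic [fset s; t]%fset h.
  split=> [Ch|].
    have /CD : C (h ^ g^-1).
      by have := (conjg_commute h s g^-1).1 Ch; rewrite sgV.
    by rewrite conjgKV.
  by apply: parabolic_commute => x; rewrite !inE => /orP [] /eqP ->.
have h2 h : C h -> h * h = 1.
  move=> /CE /(parabolic_klein ss tt (esym Ct)) [] ->; rewrite ?mulg1 //.
  by rewrite mulgA -(mulgA s t s) Ct mulgA ss mul1g.
have pre d : phi (psi (d ^ w^-1)) ^ w = d by rewrite psiK conjgKV.
(* Transported by [phi], the subgroup generated by [a] and [b] has exponent two, hence is
   abelian. *)
have D2 d : parabolic [fset a; b]%fset d -> d * d = 1.
  rewrite -{1}(pre d) => /CP /h2 e.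
  by rewrite -(pre d) -conjMg -phiM e morphic1 conj1g.
have Da := @parabolic_fset2l _ a b; have Db := @parabolic_fset2r _ a b.
have aa := D2 _ Da; have bb := D2 _ Db.
have ba : a * b = b * a.
  by rewrite -[LHS](mulg1_eq (D2 _ (parabolicM Da Db))) invgM !involV.
have mab : m' a b = Some 2 by apply: (gen_commute_m cox') => //; apply/eqP.
have mba : m' b a = Some 2 by rewrite (coxeter_m_sym cox').
have nrefl d : d \in S' -> phi s ^ w <> d.
  move=> dS e; apply: phi_s; apply: (@reflectionJ _ _ _ w); exists 1, d.
  by rewrite e invg1 mulg1 mul1g.
have sab' : phi s ^ w = a * b.
  have /CP Ds : C s by [].
  have [e|e|e|//] := parabolic_klein aa bb ba Ds.
  - by move/eqP: e; rewrite conjg_eq1 => /eqP /z1.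
  - by case: (nrefl a).
  - by case: (nrefl b).
have uN u : u \in S -> u != s -> u != t -> m s u = None.
  move=> uS us ut; case e : (m s u) => [n|//]; exfalso.
  have /CE : C u by apply: finite_order_commute; rewrite ?e.
  move=> /(parabolic_gens cox) H; have : u \in [fset s; t]%fset.
    by apply: H => //; apply/fsubsetP => x; rewrite !inE => /orP [] /eqP ->.
  by rewrite !inE (negbTE us) (negbTE ut).
have par x : parabolic [fset s; t]%fset x <-> parabolic [fset a; b]%fset (phi x ^ w).
  by apply: (iff_trans (iff_sym (CE x))); apply: iff_sym; exact: CP.
have /CP Dt := Ct.
(* The image of [t] is neither 1 nor a b; whichever of [a] and [b] it is becomes t', and the other
   becomes s'. *)
have [e|e|e|e] := parabolic_klein aa bb ba Dt.
- by move/eqP: e; rewrite conjg_eq1 -morphic1 => /eqP /phi_inj /(gen_neq1 cox tS).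
- exists t, b, a, w; rewrite eq_sym -ba (fsetUC [fset b]%fset).
  by split.
- by exists t, a, b, w; split.
- by move: e ts; rewrite -sab' => /conjg_inj /phi_inj ->; rewrite eqxx.
Qed.

End Isomorphism.

Theorem theorem1
  (W W' : groupType) (S : {fset W}) (S' : {fset W'})
  (m : W -> W -> option nat) (m' : W' -> W' -> option nat)
  (coxW : coxeter_system S m) (coxW' : coxeter_system S' m')
  (dimW : davis_dim S 2) (dimW' : davis_dim S' 2)
  (phi : {multiplicative W -> W'}) (phi_bij : bijective phi)
  (s : W) (sS : s \in S) (phi_s : ~ reflection S' (phi s)) :
  exists! p : W * W' * W',
    let: (t, s', t') := p in
    (t \in S /\ s' \in S' /\ t' \in S') /\
    exists w' : W',
      m s t = Some 2 /\
      (forall u : W, u \in S -> u != s -> u != t -> m s u = None) /\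
      phi @` parabolic [fset s; t] =
        [set w' * x * w'^-1 | x in parabolic [fset s'; t']] /\
      m' s' t' = Some 2 /\
      (forall u' : W', u' \in S' -> u' != s' -> u' != t' -> m' s' u' = None) /\
      phi s = w' * (s' * t') * w'^-1 /\
      phi t = w' * t' * w'^-1.
Proof.
have [psi phiK psiK] := phi_bij.
have phiM : {morph phi : x y / x * y} by exact: gmulfM.
have conjE (x y w : W') : x ^ w = y -> x = w * y * w^-1.
  by move=> <-; rewrite conjgE mulVKg mulgK.
have [t [s' [t' [w]]]] :=
  nonreflection_generator coxW coxW' dimW dimW' phiM phiK psiK sS phi_s.
move=> [[tS sS' tS' st'] [[mst uN mst'] [phis phit par]]].
have uN' u : u \in S' -> u != s' -> u != t' -> m' s' u = None.
  (* The inverse isomorphism maps w s' w^-1 to s t, which is not a reflection. *)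
  pose psi_w y := psi (y ^ w^-1); pose phi_w x := phi x ^ w.
  have psi_wM : {morph psi_w : x y / x * y}.
    by move=> x y; apply: (can_inj phiK); rewrite phiM !psiK conjMg.
  have psi_wK : cancel psi_w phi_w by move=> y; rewrite /phi_w psiK conjgKV.
  have phi_wK : cancel phi_w psi_w by move=> x; rewrite /psi_w conjgK phiK.
  have psi_s' : psi_w s' = s * t.
    apply: (can_inj phi_wK); rewrite psi_wK /phi_w phiM conjMg phis phit.
    by rewrite -mulgA (gen_sq coxW' tS') mulg1.
  have nrefl : ~ reflection S (psi_w s').
    have [chi [chiM chiS chi_refl]] := reflection_sign coxW.
    by move=> /chi_refl; rewrite psi_s' chiM !chiS.
  have [t2 [_ [_ [_ [[t2S _ _ _] [[mst2 t2N _] _]]]]]] :=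
    nonreflection_generator coxW' coxW dimW' dimW psi_wM psi_wK phi_wK sS' nrefl.
  (* The partner [t2] of s' must be t', because m'(s',t') is finite. *)
  move=> uS us ut; apply: (t2N) => //; apply: contra_neq ut => ->.
  apply/eqP/negPn/negP => t2t; move: mst'.
  by rewrite t2N // eq_sym.
exists (t, s', t'); split.
  split=> //; exists w; split=> //; split=> //; split.
    apply/seteqP; split=> [_ [x Dx <-]|_ [y Dy <-]].
      exists (phi x ^ w); first exact/par.
      by rewrite -(conjE _ _ _ erefl).
    exists (psi (w * y * w^-1)); last by rewrite psiK.
    by apply/par; rewrite psiK conjgE mulgVK mulKg.
  by split=> //; split=> //; split; exact: conjE.
move=> [[t2 s2] t2'] [[t2S [s2S t2S']] [w2 [mst2 [_ [_ [mst2' [_ [phis2 phit2]]]]]]]].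
have t2s : t2 != s.
  by apply: contraPneq mst2 => ->; rewrite (coxeter_m_diag coxW sS).
have t2t : t2 = t.
  by apply/eqP/negPn/negP => /(uN _ t2S t2s); rewrite mst2.
have [chi [chiM chi_gen]] : exists chi : W' -> bool,
    {morph chi : g h / g * h >-> g (+) h} /\ forall u, u \in S' -> chi u = (u == s').
  apply: (generator_character coxW' sS') => u n uS us.
  by have [->|/(uN' _ uS us) ->] := eqVneq u t'; rewrite ?mst' => // -[].
have chi_conj (w1 x : W') : chi (w1 * x * w1^-1) = chi x.
  by rewrite -(characterJ chiM x w1^-1) conjgE invgK mulgA.
(* Both t' and [t2'] are conjugate to [phi t], so the character of s' vanishes on them; its value on
   [phi s] then singles out [s2]. *)
have t2s' : t2' != s'.
  rewrite -chi_gen // -(chi_conj w2) -phit2 t2t -(characterJ chiM _ w) phit chi_gen //.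
  by rewrite eq_sym (negbTE st').
have s2s' : s2 = s'.
  apply/eqP; rewrite -chi_gen //.
  have : chi (s2 * t2') = chi (s' * t').
    by rewrite -(chi_conj w2) -phis2 -(characterJ chiM _ w) phis.
  rewrite !chiM !chi_gen // (negbTE t2s') addbF => ->.
  by rewrite eqxx eq_sym (negbTE st').
have t2t' : t2' = t'.
  by apply/eqP/negPn/negP => /(uN' _ t2S' t2s'); rewrite -s2s' mst2'.
by rewrite t2t s2s' t2t'.
Qed.
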